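(* Let $\alpha\in L^1(\mathbb{R})\cap L^\infty(\mathbb{R})$ be even with $\alpha\ge0$ almost everywhere, and let $w\in C^1(\mathbb{R})$ be odd with $w(0)=0$ and $W(\eta)=\int_0^\eta w(\rho)\,d\rho\ge0$ for all $\eta$. Suppose there are $q\ge\frac43$ and $C>0$ such that $|w(\eta)|^q\le C\,W(\eta)$ for all $\eta\in\mathbb{R}$. Then for initial data $\varphi,\psi\in L^1(\mathbb{R})\cap L^\infty(\mathbb{R})$ the Cauchy problem $$u_{tt}(x,t)=\int_{\mathbb{R}} \alpha(y-x)\, w\big(u(y,t)-u(x,t)\big)\,dy,\quad x\in\mathbb{R},\ t>0,\qquad u(x,0)=\varphi(x),\ u_t(x,0)=\psi(x)$$ has a global solution, i.e. a solution $u\in C^2([0,T],L^1(\mathbb{R})\cap L^\infty(\mathbb{R}))$ for every $T>0$. *)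

(* Defs.v *)
From HB Require Import structures.
From mathcomp Require Import all_boot all_order all_algebra.
From mathcomp Require Import all_classical all_reals all_analysis.
Set Implicit Arguments. Unset Strict Implicit. Unset Printing Implicit Defensive.
Import Order.TTheory GRing.Theory Num.Theory.
Import numFieldNormedType.Exports.
Local Open Scope classical_set_scope.
Local Open Scope ring_scope.

Section defs.
Context {R : realType}.
Notation mu := (@lebesgue_measure R).

Definition inL1Linf (f : R -> R) : Prop :=
  measurable_fun setT f /\ mu.-integrable setT (EFin \o f) /\
  exists M : R, {ae mu, forall x, `|f x| <= M}.

Definition Xnorm (f : R -> R) : \bar R :=
  ('N[mu]_1%:E[EFin \o f] + 'N[mu]_(+oo)[EFin \o f])%E.

Definition Wprim (w : R -> R) (eta : R) : R :=
  if 0 <= eta then Rintegral mu `[0, eta] w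
  else - Rintegral mu `[eta, 0] w.

Definition Xcont_on (T : R) (u : R -> R -> R) : Prop :=
  forall t, t \in `[0, T] ->
    (fun s => Xnorm (fun x => u s x - u t x)) @ (within `[0, T] (nbhs t))
      --> 0%E.

Definition Xderiv_on (T : R) (u v : R -> R -> R) : Prop :=
  forall t, t \in `[0, T] ->
    (fun s => Xnorm (fun x => (u s x - u t x) / (s - t) - v t x))
      @ (within `[0, T] (dnbhs t)) --> 0%E.

Definition C2_solution_on (alpha w phi psi : R -> R) (T : R)
    (u u1 u2 : R -> R -> R) : Prop :=
  (forall t, t \in `[0, T] -> [/\ inL1Linf (u t), inL1Linf (u1 t) & inL1Linf (u2 t)]) /\
  Xderiv_on T u u1 /\ Xderiv_on T u1 u2 /\ Xcont_on T u2 /\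
      (forall t, t \in `]0, T] ->
         {ae mu, forall x, u2 t x =
            Rintegral mu setT (fun y => alpha (y - x) * w (u t y - u t x))}) /\
  {ae mu, forall x, u 0 x = phi x} /\
  {ae mu, forall x, u1 0 x = psi x}.

Definition global_solution (alpha w phi psi : R -> R) : Prop :=
  exists u u1 u2 : R -> R -> R,
    forall T : R, 0 < T -> C2_solution_on alpha w phi psi T u u1 u2.

End defs.

(* Main.v *)
(* The force field K(u)(x) = \int alpha(y-x) w(u(y)-u(x)) dy is globally Lipschitz
   on L^1 and L^oo as soon as w is globally Lipschitz, so the equation with w
   truncated outside [-N, N] has a global solution, obtained as the limit of
   dyadic Euler polygons.  It remains to bound the solution on [0, T] uniformly
   in N.  The total energy \int v^2/2 + (1/2) \int\int alpha W is conserved, which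
   bounds v in L^2.  The local energy e(x) = v(x)^2/2 + \int alpha(y-x) W(u(y)-u(x)) dy
   satisfies de/dt = \int alpha(y-x) w(u(y)-u(x)) v(y) dy, and the growth condition
   with q >= 4/3 gives |w v| <= 1 + C W + v^4; since \int alpha v^4 is at most
   sup alpha * sup v^2 * \int v^2, the supremum of e grows at most exponentially.
   Truncations preserve W >= 0 and the growth condition when w(N) >= 0; if w(N) < 0
   for all large N, then W and hence w are bounded and v is bounded directly.

   Functions are genuine functions R -> R and all estimates hold everywhere: the
   data are first modified on null sets.  Time derivatives appear only as
   expansions with a remainder O((t-s)^2), so nothing is differentiated under an
   integral sign. *)
Require Import Defs.
From HB Require Import structures.
From mathcomp Require Import all_boot all_order all_algebra.
From mathcomp Require Import all_classical all_reals all_analysis.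
From mathcomp Require Import measurable_realfun ess_sup_inf ring lra.
Set Implicit Arguments. Unset Strict Implicit. Unset Printing Implicit Defensive.
Import Order.TTheory GRing.Theory Num.Theory.
Import numFieldNormedType.Exports.
Local Open Scope classical_set_scope.
Local Open Scope ring_scope.

(** The exponent 4/3 is dictated by the Gronwall argument. The inequality for r = sup e must be
    linear in r, and the only quantities available are sup v^2 <= 2 r and the integral of v^2. So v
    may enter with power 4 = 2 + 2, and Young's inequality leaves w with the conjugate exponent 4/3.
    The local energy carries the full integral of alpha W, the total energy only half of it. With
    full weight the terms v(x) K(u)(x) cancel pointwise; with half weight each pair of points is
    counted once and the powers cancel after integration. The energy gives no bound on u: that bound
    comes from integrating v, so it depends on T, but not on N. Hence N is chosen after the velocity
    bound and depends on T, and the solutions for different T are joined by uniqueness. The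
    constants in the remainders O((t-s)^2) do depend on N. This is harmless: the a priori bounds
    come from a discrete Gronwall inequality in which the remainders disappear as the time step is
    refined. *)

(** * Euler polygons for Lipschitz vector fields *)

(* [B f M] reads "the norm of [f] is at most [M]"; [f] has finite norm when some
   [M] exists.  A relation spares the quotient or subtype that a norm would need. *)
Record is_gauge (R : realType) (T : Type) (B : (T -> R) -> R -> Prop) : Prop :=
  IsGauge {
  gauge0 : B (fun=> 0) 0;
  gauge_ge0 : forall f M, B f M -> 0 <= M;
  gaugeD : forall f g M N, B f M -> B g N -> B (fun x => f x + g x) (M + N);
  gaugeZ : forall a f M, B f M -> B (fun x => a * f x) (`|a| * M);
  gauge_le : forall f M N, B f M -> M <= N -> B f N;
  gauge_closed : forall f M, (forall e, 0 < e -> B f (M + e)) -> B f M;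
  gauge_complete : forall (u : nat -> T -> R) (M c : R), B (u 0%N) M ->
    (forall n, B (fun x => u n.+1 x - u n x) (c / 2 ^+ n)) ->
    exists l, forall n, B (fun x => l x - u n x) (2 * c / 2 ^+ n) }.

Section gauge.
Variables (R : realType) (T : Type) (B : (T -> R) -> R -> Prop).
Hypothesis gB : is_gauge B.

Lemma gaugeB f g M N : B f M -> B g N -> B (fun x => f x - g x) (M + N).
Proof.
move=> Bf Bg; have := gaugeD gB Bf (gaugeZ gB (- 1) Bg).
rewrite normrN normr1 mul1r; congr (B _ _).
by apply/funext => x; rewrite mulN1r.
Qed.

Lemma gauge_pZ a f M : 0 <= a -> B f M -> B (fun x => a * f x) (a * M).
Proof. by move=> a0 Bf; rewrite -[in a * M](ger0_norm a0); exact: gaugeZ. Qed.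

Lemma gauge_eq f g M N : B f M -> f =1 g -> M <= N -> B g N.
Proof. by move=> Bf /funext <-; exact: gauge_le. Qed.

End gauge.

Section euler.
Variables (R : realType) (T : Type) (B : (T -> R) -> R -> Prop).
Hypothesis gB : is_gauge B.
Variables (F : (T -> R) -> T -> R) (L : R).
Hypothesis L0 : 0 <= L.
Hypothesis F0 : F (fun=> 0) =1 fun=> 0.
(** Finite norms are asked of [y] and [z] and not only of their difference: [F] will be an integral,
    and splitting the integral of a difference needs both integrands integrable. *)
Hypothesis FL : forall y z My Mz D, B y My -> B z Mz ->
  B (fun x => y x - z x) D -> B (fun x => F y x - F z x) (L * D).
Variables (y0 : T -> R) (M0 : R).
Hypothesis y0M : B y0 M0.

Let M0_ge0 : 0 <= M0. Proof. exact: gauge_ge0 y0M. Qed.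

Lemma lipschitz_gauge y M : B y M -> B (F y) (L * M).
Proof.
move=> By; apply: (gauge_eq gB (FL By (gauge0 gB) (D := M) _)) => //.
  by apply: (gauge_eq gB By) => // x; rewrite subr0.
by move=> x; rewrite F0 subr0.
Qed.

Definition euler_step (h : R) (y : T -> R) : T -> R := fun x => y x + h * F y x.
Definition euler h k := iter k (euler_step h) y0.

Lemma euler_growth h k : 0 <= h -> B (euler h k) (M0 * (1 + h * L) ^+ k).
Proof.
move=> h0; elim: k => [|k IH]; first by rewrite expr0 mulr1.
apply: (gauge_eq gB (gaugeD gB IH (gauge_pZ gB h0 (lipschitz_gauge IH)))) => //.
by rewrite (exprS (1 + h * L) k); lra.
Qed.

Section bounded_time.
Variable Tm : R.
Let Q := M0 * expR (L * Tm).
Let Q0 : 0 <= Q. Proof. by rewrite mulr_ge0// expR_ge0. Qed.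

Lemma expr_le_expR h k : 0 <= h -> k%:R * h <= Tm ->
  (1 + h * L) ^+ k <= expR (L * Tm).
Proof.
move=> h0 kT; apply: (@le_trans _ _ (expR (h * L) ^+ k)).
  by rewrite lerXn2r ?nnegrE ?expR_ge0 ?expR_ge1Dx// addr_ge0// mulr_ge0.
rewrite -expRM_natl ler_expR mulrA [leRHS]mulrC ler_wpM2r//.
Qed.

Lemma euler_bound h k : 0 <= h -> k%:R * h <= Tm -> B (euler h k) Q.
Proof.
move=> h0 kT; apply: (gauge_le gB (euler_growth k h0)).
by rewrite ler_wpM2l// expr_le_expR.
Qed.

Lemma euler_time_lipschitz h k m : 0 <= h -> (m + k)%:R * h <= Tm ->
  B (fun x => euler h (m + k) x - euler h k x) (m%:R * h * (L * Q)).
Proof.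
move=> h0; elim: m => [|m IH] kT.
  rewrite mul0r mul0r; apply: (gauge_eq gB (gauge0 gB)) => // x.
  by rewrite add0n subrr.
have kT' : (m + k)%:R * h <= Tm.
  by apply: le_trans kT; rewrite ler_wpM2r// ler_nat.
have := gaugeD gB (IH kT') (gauge_pZ gB h0 (lipschitz_gauge (euler_bound h0 kT'))).
move=> H; apply: (gauge_eq gB H) => [x|].
  by rewrite [euler h (m.+1 + k)]/= /euler_step; ring.
by rewrite -natr1; lra.
Qed.

(** The j-th further step uses [F] at a point that has moved by at most [j * h * (L * Q)], so it
    deviates from [h * F (euler h k)] by at most [j * h ^+ 2 * L ^+ 2 * Q]. Summing over j < m gives
    the bound. *)
Lemma euler_second_order h k m : 0 <= h -> (m + k)%:R * h <= Tm ->
  B (fun x => euler h (m + k) x - euler h k x - m%:R * h * F (euler h k) x)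
    (L ^+ 2 * Q * (m%:R * h) ^+ 2).
Proof.
move=> h0; elim: m => [|m IH] kT.
  apply: (gauge_eq gB (gauge0 gB)) => [x|]; first by rewrite add0n; ring.
  by rewrite mul0r expr0n mulr0.
have kT1 : (m + k)%:R * h <= Tm.
  by apply: le_trans kT; rewrite ler_wpM2r// ler_nat.
have kT2 : k%:R * h <= Tm.
  by apply: le_trans kT; rewrite ler_wpM2r// ler_nat leq_addl.
have H1 := FL (euler_bound h0 kT1) (euler_bound h0 kT2) (euler_time_lipschitz h0 kT1).
apply: (gauge_eq gB (gaugeD gB (IH kT1) (gauge_pZ gB h0 H1))) => [x|].
  by rewrite [euler h (m.+1 + k)]/= /euler_step -natr1; ring.
rewrite -natr1.
(* This is the slack of the induction step: (m + 1)^2 - m^2 - m = m + 1. *)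
have : 0 <= L ^+ 2 * Q * h ^+ 2 * (m%:R + 1).
  by rewrite mulr_ge0// !mulr_ge0// exprn_ge0.
by rewrite -subr_ge0 => ?; rewrite -subr_ge0; lra.
Qed.

(** Two half steps differ from one full step by the local error [L ^+ 2 * Q * h ^+ 2], and an
    existing error is multiplied by at most [1 + h * L]. The bound solves this recursion because the
    power of [1 + h * L] is at least 1. *)
Lemma euler_halve h k : 0 <= h -> k%:R * h <= Tm ->
  B (fun x => euler (h / 2) (2 * k) x - euler h k x)
    (k%:R * h ^+ 2 * (L ^+ 2 * Q) * (1 + h * L) ^+ k).
Proof.
move=> h0; elim: k => [|k IH] kT.
  rewrite muln0 !mul0r; apply: (gauge_eq gB (gauge0 gB)) => // x.
  by rewrite subrr.
have h20 : 0 <= h / 2 by lra.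
have kT1 : k%:R * h <= Tm.
  by apply: le_trans kT; rewrite ler_wpM2r// ler_nat.
have kT2 : (2 + 2 * k)%:R * (h / 2) <= Tm.
  apply: le_trans kT; by rewrite natrD natrM -(@natr1 _ k); lra.
have kT3 : (2 * k)%:R * (h / 2) <= Tm.
  apply: le_trans kT1; rewrite natrM; lra.
have H1 := FL (euler_bound h20 kT3) (euler_bound h0 kT1) (IH kT1).
have H2 := euler_second_order h20 kT2.
apply: (gauge_eq gB (gaugeD gB (gaugeD gB (IH kT1) (gauge_pZ gB h0 H1)) H2)) => [x|].
  by rewrite [in RHS]mulnS [euler h k.+1]/= /euler_step; field.
have e1 : 1 <= (1 + h * L) ^+ k.+1 by rewrite exprn_ege1// lerDl mulr_ge0.
rewrite -(@natr1 _ k) (_ : 2 * (h / 2) = h); last by field.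
have : h ^+ 2 * (L ^+ 2 * Q) * 1 <= h ^+ 2 * (L ^+ 2 * Q) * (1 + h * L) ^+ k.+1.
  by rewrite ler_wpM2l// !mulr_ge0// exprn_ge0.
by rewrite (exprS (1 + h * L) k); lra.
Qed.

End bounded_time.
Lemma exists_half_pow_le (K e : R) : 0 < e -> exists n, K / 2 ^+ n <= e.
Proof.
move=> e0; exists (Num.truncn (Num.max 0 (K / e))).+1.
set x := Num.max _ _; have x0 : 0 <= x by rewrite le_max lexx.
have /andP[_ xn] := truncn_itv x0; move: xn; set n := (_.+1)%N => xn.
have n2 : n%:R <= 2 ^+ n :> R by rewrite -natrX ler_nat ltnW// ltn_expl.
rewrite ler_pdivrMr ?exprn_gt0// mulrC -ler_pdivrMr//.
by apply: le_trans n2; apply: le_trans (ltW xn); rewrite le_max lexx orbT.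
Qed.

(** The value at the last grid point up to [t]: a step function in time rather than an interpolated
    polygon. The difference is of the order of the mesh and vanishes in the limit. *)
Definition euler_dyadic n (t : R) := euler (2 ^+ n)^-1 (Num.truncn (t * 2 ^+ n)).
(** The first summand pays for the at most one half step by which the two grids disagree on the
    floor of [t], the second is the bound of [euler_halve] with [k * h <= t]; one factor [h] is
    taken out of each. *)
Definition euler_modulus (t : R) :=
  let q := M0 * expR (L * t) in L * q + t * (L ^+ 2 * q * expR (L * t)).

Lemma dyadic_floor n t (k := Num.truncn (t * 2 ^+ n)) (h := (2 ^+ n)^-1 : R) :
  0 <= t -> k%:R * h <= t < k%:R * h + h.
Proof.
move=> t0; have p0 : 0 < 2 ^+ n :> R by rewrite exprn_gt0.
have tp : 0 <= t * 2 ^+ n by rewrite mulr_ge0// ltW.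
have /andP[k1 k2] := truncn_itv tp.
rewrite -[X in _ + X]mul1r -mulrDl ler_pdivrMr// ltr_pdivlMr//.
by rewrite natr1 k1 k2.
Qed.

Lemma euler_modulus_ge0 t : 0 <= t -> 0 <= euler_modulus t.
Proof. by move=> t0; rewrite addr_ge0// !mulr_ge0// ?expR_ge0// exprn_ge0. Qed.

Lemma le_euler_modulus s t : 0 <= s -> s <= t ->
  euler_modulus s <= euler_modulus t.
Proof.
move=> s0 st; have e : expR (L * s) <= expR (L * t).
  by rewrite ler_expR ler_wpM2l.
have q : M0 * expR (L * s) <= M0 * expR (L * t) by rewrite ler_wpM2l.
rewrite /euler_modulus lerD ?ler_wpM2l//.
do !(apply: ler_pM => //; rewrite ?mulr_ge0 ?exprn_ge0 ?expR_ge0//).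
Qed.

Lemma euler_dyadic_cauchy n t : 0 <= t ->
  B (fun x => euler_dyadic n.+1 t x - euler_dyadic n t x)
    (euler_modulus t / 2 ^+ n).
Proof.
move=> t0; rewrite /euler_dyadic /euler_modulus.
set q := M0 * _; have q0 : 0 <= q by rewrite mulr_ge0// expR_ge0.
have := dyadic_floor n t0; have := dyadic_floor n.+1 t0.
set k := Num.truncn (t * 2 ^+ n); set k' := Num.truncn _.
set h := (2 ^+ n)^-1; have h0 : 0 < h by rewrite invr_gt0 exprn_gt0.
have -> : (2 ^+ n.+1)^-1 = h / 2 by rewrite exprS invfM mulrC.
move=> /andP[k1 k2] /andP[l1 l2].
have kk : (2 * k <= k')%N.
  rewrite -ltnS -(ltr_nat R) -natr1 natrM.
  by rewrite -(ltr_pM2r (divr_gt0 h0 (ltr0n _ 2))); lra.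
have kk' : (k' < (2 * k).+2)%N.
  rewrite -(ltr_nat R) -natr1 -[(2 * k).+1%:R]natr1 natrM.
  by rewrite -(ltr_pM2r (divr_gt0 h0 (ltr0n _ 2))); lra.
have h20 : 0 <= h / 2 by lra.
(* The finer grid point below [t] is either the coarse one or the midpoint that follows it. *)
have [m k'E m1] : exists2 m, k' = (m + 2 * k)%N & (m <= 1)%N.
  exists (k' - 2 * k)%N; first by rewrite subnK.
  by rewrite leq_subLR addn1 -ltnS.
rewrite k'E in k1 *.
have H1 := euler_time_lipschitz h20 k1.
have H2 := euler_halve (ltW h0) l1.
apply: (gauge_eq gB (gaugeD gB H1 H2)) => [x|]; first by ring.
rewrite mulrDl lerD//.
  rewrite -/q [leRHS]mulrC ler_wpM2r ?mulr_ge0//.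
  have : m%:R <= 1 :> R by rewrite (ler_nat R m 1).
  move=> m1'; have : m%:R * (h / 2) <= 1 * (h / 2) by rewrite ler_wpM2r.
  by lra.
rewrite -/q -/h; set a := L ^+ 2 * q.
have a0 : 0 <= a by rewrite mulr_ge0// exprn_ge0.
have e := expr_le_expR (ltW h0) l1.
rewrite (_ : _ * h ^+ 2 * a * _ = (k%:R * h) * (a * (1 + h * L) ^+ k) * h); last by ring.
rewrite ler_wpM2r ?(ltW h0)// ler_pM ?mulr_ge0 ?exprn_ge0 ?(ltW h0)//.
  by rewrite addr_ge0// mulr_ge0// ltW.
by rewrite ler_wpM2l.
Qed.

Lemma euler_dyadic0 n : euler_dyadic n 0 = y0.
Proof. by rewrite /euler_dyadic mul0r truncn0. Qed.

Lemma euler_dyadic_bound n t Tm : 0 <= t <= Tm ->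
  B (euler_dyadic n t) (M0 * expR (L * Tm)).
Proof.
move=> /andP[t0 tT]; have /andP[k1 _] := dyadic_floor n t0.
by apply: euler_bound; [rewrite invr_ge0 exprn_ge0|exact: le_trans tT].
Qed.

(** A gauge controls distances only, so at time 0 the limit is fixed to be [y0] itself; the initial
    condition then holds as an equality of functions. *)
Lemma euler_dyadic_limit t : 0 <= t -> exists l, (t = 0 -> l = y0) /\
  forall n, B (fun x => l x - euler_dyadic n t x) (2 * euler_modulus t / 2 ^+ n).
Proof.
move=> t0; have [->|tn0] := eqVneq t 0.
  exists y0; split=> // n; rewrite euler_dyadic0.
  apply: (gauge_eq gB (gauge0 gB)) => [x|]; first by rewrite subrr.
  by rewrite divr_ge0// ?mulr_ge0// ?euler_modulus_ge0// exprn_ge0.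
have t1 : 0 <= t <= t by rewrite t0 lexx.
have [l Hl] := gauge_complete gB (@euler_dyadic_bound 0 t t t1)
  (fun n => euler_dyadic_cauchy n t0).
by exists l; split=> // t00; rewrite t00 eqxx in tn0.
Qed.

Theorem euler_solution : exists2 y : R -> T -> R, y 0 = y0 &
  forall Tm, 0 <= Tm -> exists C, forall s t, 0 <= s <= Tm -> 0 <= t <= Tm ->
    B (y s) C /\
    B (fun x => y t x - y s x - (t - s) * F (y s) x) (C * (t - s) ^+ 2).
Proof.
have H t : exists l, 0 <= t -> (t = 0 -> l = y0) /\
  forall n, B (fun x => l x - euler_dyadic n t x) (2 * euler_modulus t / 2 ^+ n).
  have [t0|t0] := boolP (0 <= t); last by exists y0.
  by have [l Hl] := euler_dyadic_limit t0; exists l.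
have {H}[y Hy] := choice H.
exists y => [|Tm Tm0]; first by apply: (Hy 0 (lexx _)).1.
set c := 2 * euler_modulus Tm; set q := M0 * expR (L * Tm).
have q0 : 0 <= q by rewrite mulr_ge0// expR_ge0.
have c0 : 0 <= c by rewrite mulr_ge0// euler_modulus_ge0.
have yY n t : 0 <= t <= Tm ->
    B (fun x => y t x - euler_dyadic n t x) (c * (2 ^+ n)^-1).
  move=> /andP[t0 tT]; apply: (gauge_le gB ((Hy t t0).2 n)).
  by rewrite ler_wpM2r ?invr_ge0 ?exprn_ge0// ler_wpM2l// le_euler_modulus.
have yB t : 0 <= t <= Tm -> B (y t) (c + q).
  move=> tT; have H := gaugeD gB (yY 0%N t tT) (euler_dyadic_bound 0 tT).
  by apply: (gauge_eq gB H) => [x|]; [ring|rewrite expr0 invr1 mulr1].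
pose C0 := L ^+ 2 * q; have C00 : 0 <= C0 by rewrite mulr_ge0// exprn_ge0.
have forward s t : 0 <= s -> s <= t -> t <= Tm ->
    B (fun x => y t x - y s x - (t - s) * F (y s) x) (C0 * (t - s) ^+ 2).
  move=> s0 st tT; have t0 := le_trans s0 st; have sT := le_trans st tT.
  have sI : 0 <= s <= Tm by rewrite s0.
  have tI : 0 <= t <= Tm by rewrite t0.
  apply: (gauge_closed gB) => e e0.
  (* [K] collects the coefficients of the mesh: the distances of [y s] and [y t] to the polygon, the
     replacement of [m * h] by [t - s] in the quadratic and in the linear term, and the change of
     [F] between [y s] and the polygon. *)
  pose K := c + c + C0 * (2 * Tm + 1) + L * q + Tm * (L * c).
  have [n Kn] := exists_half_pow_le K e0.
  have := yY n _ sI; have := yY n _ tI; have := @euler_dyadic_bound n _ _ sI.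
  have := dyadic_floor n s0; have := dyadic_floor n t0.
  rewrite /euler_dyadic; set h := (2 ^+ n)^-1.
  have h0 : 0 < h by rewrite invr_gt0 exprn_gt0.
  have h1 : h <= 1 by rewrite invf_le1 ?exprn_gt0// exprn_ege1// ler1n.
  have := @le_truncn R (s * 2 ^+ n) (t * 2 ^+ n).
  rewrite ler_wpM2r ?exprn_ge0// => /(_ erefl).
  set k := Num.truncn (s * _); set k' := Num.truncn _ => kk.
  have [m ->] : exists m, k' = (m + k)%N by exists (k' - k)%N; rewrite subnK.
  move=> /andP[l1 l2] /andP[k1 k2] BYs Ht Hs.
  have kT : (m + k)%:R * h <= Tm by exact: le_trans tT.
  have H1 := euler_second_order (ltW h0) kT.
  have H2 := lipschitz_gauge BYs.
  have H3 := FL (yB _ sI) BYs Hs.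
  rewrite natrD mulrDl in l1 l2.
  have a0 : `|m%:R * h - (t - s)| <= h by rewrite ler_distl; lra.
  have ts0 : 0 <= t - s by lra.
  have H4 := gaugeB gB (gaugeD gB (gaugeD gB (gaugeB gB Ht Hs) H1)
    (gaugeZ gB (m%:R * h - (t - s)) H2)) (gauge_pZ gB ts0 H3).
  apply: (gauge_eq gB H4) => [x|]; first by rewrite -/k -/h; ring.
  rewrite -/q -/C0 in Kn *.
  have b1 : `|m%:R * h - (t - s)| * (L * q) <= h * (L * q).
    by rewrite ler_wpM2r// mulr_ge0.
  have b2 : (t - s) * (L * (c * h)) <= Tm * (L * (c * h)).
    by apply: ler_wpM2r; [exact: mulr_ge0 L0 (mulr_ge0 c0 (ltW h0))|lra].
  have b3 : C0 * (m%:R * h) ^+ 2 <= C0 * ((t - s) ^+ 2 + (2 * Tm + 1) * h).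
    rewrite ler_wpM2l//; have m0 : 0 <= m%:R * h by rewrite mulr_ge0// ltW.
    have mh : m%:R * h <= t - s + h by lra.
    apply: (@le_trans _ _ ((t - s + h) ^+ 2)).
      by rewrite ler_sqr ?nnegrE//; lra.
    have : (t - s) * h <= Tm * h by rewrite ler_wpM2r ?(ltW h0)//; lra.
    have : h * h <= 1 * h by rewrite ler_wpM2r// ltW.
    by lra.
  by rewrite -/h /K in Kn; lra.
pose M := c + q; have M_ge0 : 0 <= M by rewrite addr_ge0.
pose D := C0 * Tm + L * M; have D0 : 0 <= D by rewrite addr_ge0// mulr_ge0.
exists (M + (C0 + L * D)) => s t sI tI; split.
  by apply: (gauge_le gB (yB _ sI)); rewrite lerDl addr_ge0// mulr_ge0.
have [s0 sT] := andP sI; have [t0 tT] := andP tI.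
have [st|/ltW ts] := leP s t.
  apply: (gauge_le gB (forward _ _ s0 st tT)).
  rewrite ler_wpM2r ?sqr_ge0//; have : 0 <= L * D by rewrite mulr_ge0.
  by lra.
(* Backward in time, the expansion is taken at [t] and recentred at [s]. This costs
   [(s - t) * (F (y s) - F (y t))], of second order since [y] is Lipschitz in time with constant
   [D]. *)
have H := forward _ _ t0 ts sT.
have st0 : 0 <= s - t by lra.
have H1 := gaugeD gB H (gauge_pZ gB st0 (lipschitz_gauge (yB _ tI))).
have H2 : B (fun x => y s x - y t x) (D * (s - t)).
  apply: (gauge_eq gB H1) => [x|]; first by ring.
  rewrite -/M [D * _]mulrDl lerD//; last by lra.
  by rewrite expr2 mulrA ler_wpM2r// ler_wpM2l//; lra.
have H3 := gaugeB gB (gauge_pZ gB st0 (FL (yB _ sI) (yB _ tI) H2)) H.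
apply: (gauge_eq gB H3) => [x|]; first by ring.
have : 0 <= M * (s - t) ^+ 2 by rewrite mulr_ge0// sqr_ge0.
by lra.
Qed.

End euler.

(** * The norm of L^1 and L^oo, and kernels dominated by a convolution *)

Section function_gauge.
Variable R : realType.
Notation mu := (@lebesgue_measure R).
Implicit Types (f g : R -> R) (M N D : R).

Definition gaugeX f M := [/\ measurable_fun setT f, forall x, `|f x| <= M &
  (\int[mu]_x `|f x|%:E <= M%:E)%E].

Lemma measurable_norm_EFin f : measurable_fun setT f ->
  measurable_fun setT (fun x => `|f x|%:E).
Proof. by move=> mf; apply/measurable_EFinP; exact: measurableT_comp. Qed.

Lemma gaugeX_ge0 f M : gaugeX f M -> 0 <= M.
Proof. by move=> [_ /(_ 0) fM _]; exact: le_trans fM. Qed.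

Lemma integral_normZ_EFin a f : measurable_fun setT f ->
  (\int[mu]_x `|a * f x|%:E = `|a|%:E * \int[mu]_x `|f x|%:E)%E.
Proof.
move=> mf; rewrite -ge0_integralZl_EFin//; last exact: measurable_norm_EFin.
by apply: eq_integral => x _; rewrite normrM EFinM.
Qed.

(** The uniform bounds make the sequence converge at every point; the L^1 bound passes to this
    pointwise limit by Fatou's lemma. *)
Lemma gaugeX_complete (u : nat -> R -> R) (M c : R) : gaugeX (u 0%N) M ->
  (forall n, gaugeX (fun x => u n.+1 x - u n x) (c / 2 ^+ n)) ->
  exists l, forall n, gaugeX (fun x => l x - u n x) (2 * c / 2 ^+ n).
Proof.
move=> u0M uc.
have c0 : 0 <= c by have := gaugeX_ge0 (uc 0%N); rewrite expr0 divr1.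
have mu_ n : measurable_fun setT (u n).
  elim: n => [|n IH]; first by case: u0M.
  rewrite (_ : u n.+1 = fun x => (u n.+1 x - u n x) + u n x); last first.
    by apply/funext => x; rewrite subrK.
  by apply: measurable_funD => //; case: (uc n).
(* The exact partial sum of the geometric series is kept, so that the induction on [m] closes with
   equality. *)
have dist m n x : `|u (m + n)%N x - u n x| <= 2 * c / 2 ^+ n * (1 - (2 ^+ m)^-1).
  elim: m => [|m IH]; first by rewrite add0n subrr normr0 expr0 invr1 subrr mulr0.
  rewrite (_ : _ - u n x = (u (m.+1 + n)%N x - u (m + n)%N x) +
    (u (m + n)%N x - u n x)); last by ring.
  apply: (le_trans (ler_normD _ _)).
  have [_ /(_ x) H _] := uc (m + n)%N.
  have := lerD H IH; move/le_trans; apply.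
  rewrite le_eqVlt; apply/orP; left; apply/eqP.
  by rewrite exprD exprS; field; rewrite !expf_neq0.
have idist m n : (\int[mu]_x `|u (m + n)%N x - u n x|%:E <=
    (2 * c / 2 ^+ n * (1 - (2 ^+ m)^-1))%:E)%E.
  elim: m => [|m IH].
    rewrite expr0 invr1 subrr mulr0 (eq_integral (cst 0%E)) ?integral0//.
    by move=> x _ /=; rewrite subrr normr0.
  have [mum _ H] := uc (m + n)%N.
  have := leeD H IH; rewrite -ge0_integralD//; last 2 first.
  - exact: measurable_norm_EFin.
  - by apply: measurable_norm_EFin; exact: measurable_funB.
  move=> K; apply: (@le_trans _ _ (\int[mu]_x
      (`|u (m.+1 + n)%N x - u (m + n)%N x|%:E + `|u (m + n)%N x - u n x|%:E))%E).
    apply: ge0_le_integral => //.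
    - by apply: measurable_norm_EFin; exact: measurable_funB.
    - by apply: emeasurable_funD; apply: measurable_norm_EFin; exact: measurable_funB.
    move=> x _; rewrite -EFinD lee_fin; apply: le_trans (ler_normD _ _).
    by rewrite addrA subrK.
  apply: (le_trans K); rewrite -EFinD lee_fin.
  rewrite le_eqVlt; apply/orP; left; apply/eqP.
  by rewrite exprD exprS; field; rewrite !expf_neq0.
have shrink m n : 2 * c / 2 ^+ n * (1 - (2 ^+ m)^-1) <= 2 * c / 2 ^+ n.
  rewrite -[leRHS]mulr1; apply: ler_wpM2l.
    by rewrite divr_ge0// ?mulr_ge0// exprn_ge0.
  by rewrite gerBl invr_ge0 exprn_ge0.
have cu x : cvgn (fun n => u n x).
  apply/cauchy_cvgP; apply: cauchy_exP => e e0.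
  have [n ne] := exists_half_pow_le (2 * c) (divr_gt0 e0 (ltr0n _ 2)).
  exists (u n x), n => //= m /= nm.
  rewrite /ball/= distrC -(subnK nm).
  have := le_trans (dist (m - n)%N n x) (shrink _ _).
  by move/le_lt_trans; apply; apply: (le_lt_trans ne); lra.
pose l x := limn (fun n => u n x).
have ml : measurable_fun setT l.
  by apply: (measurable_fun_cvg mu_) => x _; exact: cu.
exists l => n; have lun x : (fun m => `|u (m + n)%N x - u n x|) @ \oo --> `|l x - u n x|.
  apply: cvg_norm; apply: cvgB; last exact: cvg_cst.
  by rewrite (@cvg_shiftn _ _ (fun n => u n x)); exact: cu.
split.
- exact: measurable_funB.
- move=> x; rewrite -(cvg_lim _ (lun x))//; apply: limr_le; first exact: cvgP (lun x).
  by apply: nearW => m; exact: le_trans (dist m n x) (shrink _ _).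
pose f (m : nat) (x : R) : \bar R := `|u (m + n)%N x - u n x|%:E.
have mf m : measurable_fun setT (f m).
  by apply: measurable_norm_EFin; exact: measurable_funB.
have fge0 (m : nat) (x : R) : setT x -> (0 <= f m x)%E by move=> _; rewrite lee_fin.
have fl x : (f m x @[m --> \oo] --> `|l x - u n x|%:E)%E.
  by apply: cvg_EFin; [exact: nearW|exact: lun].
have := fatou mu measurableT mf fge0.
under eq_integral => x _ do rewrite (cvg_limn_einf_sup (fl x)).1.
move/le_trans; apply; rewrite limn_einf_lim; apply: lime_le; first exact: is_cvg_einfs.
apply: nearW => m; apply: (@le_trans _ _ (\int[mu]_x (f m x))%E).
  by apply: ereal_inf_lbound; exists m => /=.
by apply: (le_trans (idist m n)); rewrite lee_fin shrink.
Qed.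

Lemma gaugeX_is_gauge : is_gauge gaugeX.
Proof.
split.
- split=> [||]; first exact: measurable_cst.
    by move=> x; rewrite normr0.
  by under eq_integral do rewrite normr0; rewrite integral0.
- exact: gaugeX_ge0.
- move=> f g M N [mf fM iM] [mg gN iN]; split; first exact: measurable_funD.
    by move=> x; rewrite (le_trans (ler_normD _ _))// lerD.
  apply: (@le_trans _ _ (\int[mu]_x (`|f x|%:E + `|g x|%:E))%E).
    apply: ge0_le_integral => //.
    - by apply: measurable_norm_EFin; exact: measurable_funD.
    - by apply: emeasurable_funD; exact: measurable_norm_EFin.
    by move=> x _; rewrite -EFinD lee_fin ler_normD.
  by rewrite ge0_integralD//; [rewrite EFinD leeD|exact: measurable_norm_EFin..].
- move=> a f M [mf fM iM]; split; first exact: measurable_funM.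
    by move=> x; rewrite normrM ler_wpM2l.
  by rewrite integral_normZ_EFin// EFinM lee_pmul// integral_ge0.
- move=> f M N [mf fM iM] MN; split=> [//|x|]; first exact: le_trans MN.
  by apply: le_trans iM _; rewrite lee_fin.
- move=> f M H; split; first by case: (H 1 ltr01).
    by move=> x; apply/ler_addgt0Pr => e /H[].
  by apply/lee_addgt0Pr => e /H[_ _]; rewrite EFinD.
- exact: gaugeX_complete.
Qed.

Lemma gaugeX_integrable f M : gaugeX f M -> mu.-integrable setT (EFin \o f).
Proof.
move=> [mf _ iM]; apply/integrableP; split; first exact/measurable_EFinP.
exact: le_lt_trans iM (ltry _).
Qed.

Lemma gaugeX_Rintegral f M : gaugeX f M -> `|\int[mu]_x f x| <= M.
Proof.
move=> Bf; rewrite -lee_fin EFin_normr_Rintegral//; last exact: gaugeX_integrable Bf.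
have [mf _ iM] := Bf; apply: le_trans iM; apply: le_abse_integral => //.
exact/measurable_EFinP.
Qed.

Lemma gaugeX_mul f g M N : gaugeX f M -> measurable_fun setT g ->
  (forall x, `|g x| <= N) -> gaugeX (fun x => g x * f x) (N * M).
Proof.
move=> [mf fM iM] mg gN; have N0 : 0 <= N := le_trans (normr_ge0 _) (gN 0).
split; first exact: measurable_funM.
  by move=> x; rewrite normrM ler_pM.
apply: (@le_trans _ _ (\int[mu]_x `|N * f x|%:E)%E).
  apply: ge0_le_integral => //.
  - by apply: measurable_norm_EFin; exact: measurable_funM.
  - by apply: measurable_norm_EFin; exact: measurable_funM.
  by move=> x _; rewrite lee_fin !normrM ler_wpM2r// (le_trans (gN x))// ler_norm.
by rewrite integral_normZ_EFin// ger0_norm// EFinM lee_pmul// integral_ge0.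
Qed.

Lemma lebesgue_measure_shift (a : R) (A : set R) : measurable A ->
  pushforward mu ((fun x => x - a) : _ -> measurableTypeR R) A = mu A.
Proof.
move=> mA; have ms : measurable_fun setT ((fun x => x - a) : R -> R).
  exact: measurable_funB.
apply/esym/lebesgue_measure_unique => //= _ [[c b]] _ <-.
rewrite /pushforward (_ : _ @^-1` _ = `]c + a, b + a]%classic); last first.
  by apply/seteqP; split=> x /=; rewrite !in_itv/= ltrBrDr lerBlDr.
rewrite !lebesgue_measure_itv/= !lte_fin ltrD2r.
by case: ifPn => // _; rewrite -!EFinB; congr EFin; ring.
Qed.

Lemma ge0_integral_shift (f : R -> R) (a : R) : measurable_fun setT f ->
  (forall x, 0 <= f x) -> (\int[mu]_x (f (x - a))%:E = \int[mu]_x (f x)%:E)%E.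
Proof.
move=> mf f0.
pose sh : R -> measurableTypeR R := fun x => x - a.
have ms : measurable_fun setT sh by exact: measurable_funB.
transitivity (\int[pushforward mu sh]_x (f x)%:E)%E.
  rewrite ge0_integral_pushforward//; first exact/measurable_EFinP.
  by move=> x _; rewrite lee_fin.
by apply: eq_measure_integral => A mA _; exact: lebesgue_measure_shift.
Qed.

End function_gauge.

Section kernel.
Variable R : realType.
Notation mu := (@lebesgue_measure R).
Variables (a : R -> R) (A : R).
Hypothesis ma : measurable_fun setT a.
Hypothesis a0 : forall x, 0 <= a x.
Hypothesis aN : forall x, a (- x) = a x.
Hypothesis aA : (\int[mu]_x (a x)%:E = A%:E)%E.

Let A0 : 0 <= A.
Proof. by rewrite -lee_fin -aA integral_ge0// => x _; rewrite lee_fin. Qed.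

Lemma measurable_kernel : measurable_fun setT (fun p : R * R => a (p.2 - p.1)).
Proof. by apply: measurableT_comp => //; exact: measurable_funB. Qed.

Lemma integral_kernel x : (\int[mu]_y (a (y - x))%:E = A%:E)%E.
Proof. by rewrite ge0_integral_shift. Qed.

Lemma integral_kernelN y : (\int[mu]_x (a (y - x))%:E = A%:E)%E.
Proof.
rewrite -aA -(ge0_integral_shift y ma a0); apply: eq_integral => x _.
by rewrite -aN opprB.
Qed.

Lemma measurable_shift_kernel x : measurable_fun setT (fun y : R => a (y - x)).
Proof. by apply: measurableT_comp => //; exact: measurable_funB. Qed.

Section dominated_kernel.
Variables (k : R * R -> R) (g : R -> R) (D : R).
Hypothesis mk : measurable_fun setT k.
(** The common shape of all the kernels below: force, difference of forces, potential energy, power,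
    and remainder of the energy expansion. It yields the sup and the L^1 bound with the same
    constant [2 * A * D]. *)
Hypothesis kg : forall x y, `|k (x, y)| <= a (y - x) * (`|g y| + `|g x|).
Hypothesis gD : gaugeX g D.

Let D0 : 0 <= D. Proof. exact: gaugeX_ge0 gD. Qed.

Let mk2 x : measurable_fun setT (fun y => k (x, y)).
Proof. by apply: measurableT_comp => //; exact: measurable_pair2. Qed.

Lemma dominated_kernel_le x : (\int[mu]_y `|k (x, y)|%:E <= (2 * A * D)%:E)%E.
Proof.
have [mg gM _] := gD.
apply: (@le_trans _ _ (\int[mu]_y (2 * D * a (y - x))%:E)%E).
  apply: ge0_le_integral => //; first exact: measurable_norm_EFin.
    by apply/measurable_EFinP/measurable_funM => //; exact: measurable_shift_kernel.
  move=> y _; rewrite lee_fin (le_trans (kg _ _))// mulrC ler_wpM2r//.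
  by rewrite mulr_natl mulr2n lerD.
under eq_integral do rewrite EFinM.
rewrite ge0_integralZl_EFin//.
- by rewrite integral_kernel -EFinM lee_fin; lra.
- by move=> y _; rewrite lee_fin.
- by apply/measurable_EFinP; exact: measurable_shift_kernel.
- by rewrite mulr_ge0.
Qed.

Lemma dominated_kernel_integrable x : mu.-integrable setT (fun y => (k (x, y))%:E).
Proof.
apply/integrableP; split; first by apply/measurable_EFinP; exact: mk2.
exact: le_lt_trans (dominated_kernel_le x) (ltry _).
Qed.

Let measurable_norm_iterated :
  measurable_fun setT (fun x => \int[mu]_y `|k (x, y)|%:E)%E.
Proof.
apply: (@measurable_fun_fubini_tonelli_F _ _ _ _ R mu (fun p => `|k p|%:E)) => //.
by apply/measurable_EFinP; exact: measurableT_comp.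
Qed.

(** The part with [g x] is integrated in [y] first. For the part with [g y] Tonelli exchanges the
    order, and the evenness of [a] gives the kernel the same mass [A] in the variable [x]. *)
Lemma dominated_kernel_iterated_le :
  (\int[mu]_x \int[mu]_y `|k (x, y)|%:E <= (2 * A * D)%:E)%E.
Proof.
have [mg gM ig] := gD.
have mag1 : measurable_fun setT (fun p : R * R => (a (p.2 - p.1) * `|g p.2|)%:E).
  apply/measurable_EFinP/measurable_funM; first exact: measurable_kernel.
  by apply: measurableT_comp => //; apply: measurableT_comp.
have mag2 : measurable_fun setT (fun p : R * R => (a (p.2 - p.1) * `|g p.1|)%:E).
  apply/measurable_EFinP/measurable_funM; first exact: measurable_kernel.
  by apply: measurableT_comp => //; apply: measurableT_comp.
have ag1 p : (0 <= (a (p.2 - p.1) * `|g p.2|)%:E)%E by rewrite lee_fin mulr_ge0.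
have ag2 p : (0 <= (a (p.2 - p.1) * `|g p.1|)%:E)%E by rewrite lee_fin mulr_ge0.
have mF1 : measurable_fun setT (fun x : R => \int[mu]_y (a (y - x) * `|g y|)%:E)%E.
  exact: (@measurable_fun_fubini_tonelli_F _ _ _ _ R mu
    (fun p : R * R => (a (p.2 - p.1) * `|g p.2|)%:E)).
have mF2 : measurable_fun setT (fun x : R => \int[mu]_y (a (y - x) * `|g x|)%:E)%E.
  exact: (@measurable_fun_fubini_tonelli_F _ _ _ _ R mu
    (fun p : R * R => (a (p.2 - p.1) * `|g p.1|)%:E)).
have mfst x : measurable_fun setT (fun y : R => (a (y - x) * `|g y|)%:E).
  apply/measurable_EFinP/measurable_funM; first exact: measurable_shift_kernel.
  by apply: measurableT_comp.
have msnd x : measurable_fun setT (fun y : R => (a (y - x) * `|g x|)%:E).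
  by apply/measurable_EFinP/measurable_funM => //; exact: measurable_shift_kernel.
apply: (@le_trans _ _ (\int[mu]_x (\int[mu]_y (a (y - x) * `|g y|)%:E +
    \int[mu]_y (a (y - x) * `|g x|)%:E))%E).
  apply: ge0_le_integral => //.
  - by move=> x _; exact: integral_ge0.
  - exact: emeasurable_funD.
  - move=> x _; rewrite -ge0_integralD//; last 4 first.
    - by move=> y _; rewrite lee_fin mulr_ge0.
    - exact: mfst.
    - by move=> y _; rewrite lee_fin mulr_ge0.
    - exact: msnd.
    apply: ge0_le_integral => //; first exact: measurable_norm_EFin.
      by apply: emeasurable_funD; [exact: mfst|exact: msnd].
    by move=> y _; rewrite -EFinD lee_fin -mulrDr.
rewrite ge0_integralD//; last 2 first.
- by move=> x _; apply: integral_ge0 => y _; rewrite lee_fin mulr_ge0.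
- by move=> x _; apply: integral_ge0 => y _; rewrite lee_fin mulr_ge0.
have -> : (2 * A * D)%:E = (A%:E * D%:E + A%:E * D%:E)%E.
  by rewrite -!EFinM -EFinD; congr EFin; ring.
have AgD : (\int[mu]_x (A%:E * `|g x|%:E) <= A%:E * D%:E)%E.
  rewrite ge0_integralZl_EFin//; last exact: measurable_norm_EFin.
  by rewrite lee_pmul// integral_ge0.
apply: leeD.
  rewrite [leLHS](@fubini_tonelli _ _ _ _ R mu mu
    (fun p : R * R => (a (p.2 - p.1) * `|g p.2|)%:E))//=.
  apply: le_trans AgD; rewrite le_eqVlt; apply/orP; left; apply/eqP.
  apply: eq_integral => y _; under eq_integral do rewrite mulrC EFinM.
  rewrite ge0_integralZl_EFin//; last 2 first.
  - by move=> x _; rewrite lee_fin.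
  - by apply/measurable_EFinP; apply: measurableT_comp => //; exact: measurable_funB.
  by rewrite muleC; congr (_ * _)%E; exact: integral_kernelN.
apply: le_trans AgD; rewrite le_eqVlt; apply/orP; left; apply/eqP.
apply: eq_integral => x _; under eq_integral do rewrite mulrC EFinM.
rewrite ge0_integralZl_EFin//; last 2 first.
- by move=> y _; rewrite lee_fin.
- by apply/measurable_EFinP; exact: measurable_shift_kernel.
by rewrite muleC; congr (_ * _)%E; exact: integral_kernel.
Qed.

Lemma dominated_kernel_product_integrable :
  (mu \x mu)%E.-integrable setT (EFin \o k).
Proof.
apply/integrable12ltyP; first exact/measurable_EFinP.
exact: le_lt_trans dominated_kernel_iterated_le (ltry _).
Qed.

Lemma dominated_kernel_gaugeX : gaugeX (fun x => \int[mu]_y k (x, y)) (2 * A * D).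
Proof.
have norm_le x : (`|\int[mu]_y k (x, y)|%:E <= \int[mu]_y `|k (x, y)|%:E)%E.
  rewrite EFin_normr_Rintegral//; last exact: dominated_kernel_integrable.
  by apply: le_abse_integral => //; apply/measurable_EFinP; exact: mk2.
have mI : measurable_fun setT (fun x => \int[mu]_y k (x, y)).
  apply: measurableT_comp => //.
  exact: measurable_fubini_F dominated_kernel_product_integrable.
split=> // [x|].
  by rewrite -lee_fin; exact: le_trans (norm_le x) (dominated_kernel_le x).
apply: le_trans dominated_kernel_iterated_le; apply: ge0_le_integral => //.
exact: measurable_norm_EFin.
Qed.

End dominated_kernel.

Lemma dominated_kernel_swap (k : R * R -> R) (g : R -> R) (D : R) :
  measurable_fun setT k ->
  (forall x y, `|k (x, y)| <= a (y - x) * (`|g y| + `|g x|)) -> gaugeX g D ->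
  \int[mu]_x \int[mu]_y k (x, y) = \int[mu]_x \int[mu]_y k (y, x).
Proof.
move=> mk kg gD.
have mk' : measurable_fun setT (fun p => k (p.2, p.1)).
  by apply: measurableT_comp => //; exact: measurable_fun_pair.
have kg' x y : `|(fun p => k (p.2, p.1)) (x, y)| <= a (y - x) * (`|g y| + `|g x|).
  by rewrite /= -(aN (y - x)) opprB [X in _ * X]addrC kg.
have ik := dominated_kernel_product_integrable mk kg gD.
rewrite /Rintegral; congr fine.
transitivity (\int[mu]_x \int[mu]_y (k (x, y))%:E)%E.
  apply: eq_integral => x _; rewrite fineK//; apply: integrable_fin_num => //.
  exact: dominated_kernel_integrable mk kg gD x.
rewrite (Fubini ik); apply: eq_integral => y _; rewrite fineK//.
apply: integrable_fin_num => //.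
exact: dominated_kernel_integrable mk' kg' gD y.
Qed.

End kernel.

(** * Gronwall's inequality, truncation and growth of the nonlinearity *)

(* [P t r] reads "the quantity at time [t] is at most [r]".  The error [C * h ^+ 2]
   vanishes when the subdivision of [0, t] is refined. *)
Lemma discrete_gronwall (R : realType) (P : R -> R -> Prop) (T A B C r0 : R) :
  0 <= A -> 0 <= B -> 0 <= C -> 0 <= r0 ->
  (forall t r r', P t r -> r <= r' -> P t r') ->
  (forall s t r, 0 <= s -> s <= t -> t <= T -> 0 <= r -> P s r ->
    P t (r + (t - s) * (A + B * r) + C * (t - s) ^+ 2)) ->
  P 0 r0 ->
  forall t e, 0 <= t <= T -> 0 < e -> P t ((r0 + A * t) * expR (B * t) + e).
Proof.
move=> A0 B0 C0 r00 Ple Pstep P0 t e /andP[t0 tT] e0.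
have [n en] := exists_half_pow_le (expR (B * t) * (C * t ^+ 2)) e0.
(* [N] equal steps accumulate the error [C * t ^+ 2 / N]; [n] was chosen so that it stays below [e]
   even after multiplication by [expR (B * t)]. *)
pose N := (2 ^ n)%N; have N0 : 0 < N%:R :> R by rewrite ltr0n expn_gt0.
pose h := t / N%:R; have h0 : 0 <= h by rewrite divr_ge0// ltW.
have Nh : N%:R * h = t by rewrite mulrC divfK// gt_eqF.
have Bh : 1 <= 1 + B * h by rewrite lerDl mulr_ge0.
pose q := A * h + C * h ^+ 2.
have q0 : 0 <= q by rewrite addr_ge0// mulr_ge0// exprn_ge0.
(* Each step multiplies by [1 + B * h] and adds [q]; the new [q] fits inside the bracket because the
   power in front is at least 1. *)
have Pk k : (k <= N)%N -> P (k%:R * h) ((1 + B * h) ^+ k * (r0 + k%:R * q)).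
  elim: k => [_|k IH kN]; first by rewrite !mul0r expr0 mul1r addr0.
  have kN' : k.+1%:R * h <= t by rewrite -Nh ler_wpM2r// ler_nat.
  have pk0 : 0 <= (1 + B * h) ^+ k * (r0 + k%:R * q).
    by rewrite mulr_ge0 ?addr_ge0 ?mulr_ge0// exprn_ge0// addr_ge0 ?mulr_ge0.
  have := Pstep _ (k.+1%:R * h) _ _ _ _ pk0 (IH (ltnW kN)).
  move=> /(_ _ _ (le_trans kN' tT)) H.
  have := H _ _; rewrite mulr_ge0// ler_wpM2r ?ler_nat// => /(_ erefl erefl) {}H.
  apply: (Ple _ _ _ H); rewrite -(@natr1 _ k).
  rewrite (_ : (k%:R + 1) * h - _ = h); last by ring.
  have : 1 * q <= (1 + B * h) ^+ k.+1 * q by rewrite ler_wpM2r// exprn_ege1.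
  by rewrite (exprS (1 + B * h) k) /q; lra.
have := Pk N (leqnn _); rewrite Nh => H; apply: (Ple _ _ _ H).
have E : (1 + B * h) ^+ N <= expR (B * t).
  rewrite -Nh [B * (_ * h)]mulrCA expRM_natl lerXn2r ?nnegrE ?expR_ge0//.
    by apply: le_trans Bh.
  exact: expR_ge1Dx.
have NE : N%:R * q = A * t + C * t ^+ 2 / 2 ^+ n.
  by rewrite /q /h /N natrX; field; rewrite expf_neq0.
rewrite NE; apply: (@le_trans _ _
  (expR (B * t) * (r0 + (A * t + C * t ^+ 2 / 2 ^+ n)))).
  by rewrite ler_wpM2r// !addr_ge0// !mulr_ge0 ?exprn_ge0// invr_ge0 exprn_ge0.
by lra.
Qed.

Section primitive.
Variables (R : realType) (w : R -> R).
Notation mu := (@lebesgue_measure R).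
Hypothesis wc : continuous w.

Lemma continuous_integrable_itv (a b : R) : mu.-integrable `[a, b] (EFin \o w).
Proof.
apply: continuous_compact_integrable; first exact: segment_compact.
exact: continuous_subspaceT.
Qed.

Lemma Rintegral_chasles (a b c : R) : a <= b -> b <= c ->
  \int[mu]_(x in `[a, c]) w x = \int[mu]_(x in `[a, b]) w x + \int[mu]_(x in `[b, c]) w x.
Proof.
move=> ab bc; have ib := continuous_integrable_itv b c.
rewrite -(Rintegral_itv_obnd_cbnd (r := b)); last first.
  by apply: integrableS ib => //; apply: subset_itvr; rewrite bnd_simp.
rewrite -(Rintegral_itvB (a := BLeft a)); first by rewrite addrC subrK.
- exact: continuous_integrable_itv.
- by rewrite bnd_simp.
- by rewrite bnd_simp.
Qed.

Lemma Wprim_diff (a b : R) : a <= b ->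
  Wprim w b - Wprim w a = \int[mu]_(x in `[a, b]) w x.
Proof.
move=> ab; rewrite /Wprim; case: ifPn => b0; case: ifPn => a0.
- by rewrite (Rintegral_chasles a0 ab) addrC addKr.
- by rewrite opprK addrC -Rintegral_chasles// ltW// ltNge.
- by rewrite (le_trans a0 ab) in b0.
- have b0' : b <= 0 by rewrite ltW// ltNge.
  by rewrite opprK (Rintegral_chasles ab b0') addrC addrK.
Qed.

(** For [x <= y] the remainder is the integral of [w - w x] over the segment, at most
    [L * (y - x) ^+ 2]. For [y < x] the expansion is recentred from [y] to [x], which costs the same
    amount once more: hence the factor 2. *)
Lemma Wprim_second_order (N L : R) :
  (forall x y, -N <= x <= N -> -N <= y <= N -> `|w x - w y| <= L * `|x - y|) ->
  forall x y, -N <= x <= N -> -N <= y <= N ->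
  `|Wprim w y - Wprim w x - w x * (y - x)| <= 2 * L * (y - x) ^+ 2.
Proof.
move=> wL.
have ordered x y : -N <= x <= N -> -N <= y <= N -> x <= y ->
    `|Wprim w y - Wprim w x - w x * (y - x)| <= L * (y - x) ^+ 2.
  move=> xN yN xy; rewrite Wprim_diff//.
  have cE c : \int[mu]_(z in `[x, y]) c = c * (y - x).
    rewrite Rintegral_cst//= lebesgue_measure_itv/= lte_fin.
    by move: xy; rewrite le_eqVlt => /predU1P[->|->]//; rewrite ltxx subrr.
  have ic c : mu.-integrable `[x, y] (EFin \o (fun=> c)).
    apply: continuous_compact_integrable; first exact: segment_compact.
    by apply: continuous_subspaceT; exact: cst_continuous.
  have wz z : `[x, y]%classic z -> `|w z - w x| <= L * (y - x).
    rewrite /= in_itv/= => /andP[xz zy].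
    have L0 : 0 <= L * `|z - x|.
      by apply: le_trans (wL z x _ _) => //; lra.
    have zN : -N <= z <= N by lra.
    apply: (le_trans (wL _ _ zN xN)).
    rewrite ger0_norm ?subr_ge0// in L0 *.
    (* The sign of [L] is not given; a negative [L] leaves room only for [z = x]. *)
    have [L1|L1] := leP 0 L; first by rewrite ler_wpM2l//; lra.
    have : z - x = 0 by apply/eqP; rewrite eq_le subr_ge0 xz andbT -(nmulr_rge0 _ L1).
    have Ly : 0 <= L * `|y - x| by apply: le_trans (wL y x _ _).
    by move=> ->; rewrite mulr0; rewrite ger0_norm ?subr_ge0// in Ly.
  have iw := continuous_integrable_itv x y.
  have u : \int[mu]_(z in `[x, y]) w z <= \int[mu]_(z in `[x, y]) (w x + L * (y - x)).
    apply: le_Rintegral => // z /wz; rewrite ler_norml => /andP[? ?]; lra.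
  have l : \int[mu]_(z in `[x, y]) (w x - L * (y - x)) <= \int[mu]_(z in `[x, y]) w z.
    apply: le_Rintegral => // z /wz; rewrite ler_norml => /andP[? ?]; lra.
  rewrite !cE in u l; move: (\int[mu]_(z in `[x, y]) w z) u l => I u l.
  by rewrite ler_norml; lra.
move=> x y xN yN; have [xy|yx] := leP x y.
  have H := ordered x y xN yN xy; apply: (le_trans H).
  have H0 : 0 <= L * (y - x) ^+ 2 by exact: le_trans (normr_ge0 _) H.
  by lra.
have H := ordered y x yN xN (ltW yx).
have xy0 : 0 < x - y by rewrite subr_gt0.
have wyx := wL x y xN yN; rewrite (gtr0_norm xy0) in wyx.
have : `|(w x - w y) * (x - y)| <= L * (x - y) * (x - y).
  by rewrite normrM (gtr0_norm xy0) ler_wpM2r// ltW.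
by rewrite ler_norml => H1; rewrite ler_norml in H; rewrite ler_norml; lra.
Qed.

End primitive.

Section truncation.
Variable R : realType.
Implicit Types N x y : R.

Definition clip N x : R := Num.max (- N) (Num.min N x).

Lemma clip_cases N x : 0 <= N ->
  [\/ N <= x /\ clip N x = N, - N <= x <= N /\ clip N x = x
    | x <= - N /\ clip N x = - N].
Proof.
move=> N0; rewrite /clip; have [Nx|xN] := leP N x.
  by constructor 1; split=> //; case: (leP (- N) N) => ?; lra.
have [Nx|Nx] := leP (- N) x; first by constructor 2; split=> //; lra.
by constructor 3; split=> //; lra.
Qed.

Lemma clip_itv N x : 0 <= N -> - N <= clip N x <= N.
Proof. by move=> N0; have [] := clip_cases x N0 => -[? ->]; lra. Qed.

Lemma clip_id N x : `|x| <= N -> clip N x = x.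
Proof.
move=> xN; have N0 := le_trans (normr_ge0 _) xN.
move: xN; rewrite ler_norml => /andP[? ?].
by have [] := clip_cases x N0 => -[? ->]; lra.
Qed.

Lemma clipN N x : 0 <= N -> clip N (- x) = - clip N x.
Proof.
move=> N0; have [] := clip_cases x N0; have [] := clip_cases (- x) N0 => -[? ->] [? ->]; lra.
Qed.

Lemma clip_lipschitz N x y : 0 <= N -> `|clip N x - clip N y| <= `|x - y|.
Proof.
move=> N0; have d1 : x - y <= `|x - y| by exact: ler_norm.
have d2 : - (x - y) <= `|x - y| by rewrite -normrN ler_norm.
have := normr_ge0 (x - y); move: `|x - y| d1 d2 => d d1 d2 d0; rewrite ler_norml.
by have [] := clip_cases x N0; have [] := clip_cases y N0 => -[? ->] [? ->]; lra.
Qed.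

(** Expanding the truncated potential leaves the product of [w (clip N y) - w (clip N x)] and
    [y - clip N y]. One factor vanishes in the first and third cases; in the second the overshoot of
    [y] is at most the distance of the points, so the product is quadratic there too. *)
Lemma clip_defect N x y : 0 <= N ->
  [\/ clip N y = y, `|y - clip N y| <= `|x - y| | clip N x = clip N y].
Proof.
move=> N0; have d1 : x - y <= `|x - y| by exact: ler_norm.
have d2 : - (x - y) <= `|x - y| by rewrite -normrN ler_norm.
have := normr_ge0 (x - y); move: `|x - y| d1 d2 => d d1 d2 d0; rewrite ler_norml.
have [] := clip_cases x N0; have [] := clip_cases y N0 => -[? ->] [? ->];
  by [constructor 1; lra|constructor 3; lra|constructor 2; lra].
Qed.

Variables (w W : R -> R) (N L : R).
Hypotheses (N0 : 0 <= N) (L0 : 0 <= L).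
Hypothesis wL : forall x y, - N <= x <= N -> - N <= y <= N ->
  `|w x - w y| <= L * `|x - y|.
Hypothesis W2 : forall x y, - N <= x <= N -> - N <= y <= N ->
  `|W y - W x - w x * (y - x)| <= 2 * L * (y - x) ^+ 2.

Definition trunc_force x := w (clip N x).
(* The primitive of [trunc_force]: [W] continued affinely outside [- N, N]. *)
Definition trunc_potential x := W (clip N x) + w (clip N x) * (x - clip N x).

Lemma trunc_force_lipschitz x y :
  `|trunc_force x - trunc_force y| <= L * `|x - y|.
Proof.
apply: (le_trans (wL (clip_itv x N0) (clip_itv y N0))).
by rewrite ler_wpM2l// clip_lipschitz.
Qed.

Lemma trunc_potential_second_order x y :
  `|trunc_potential y - trunc_potential x - trunc_force x * (y - x)| <=
    3 * L * (y - x) ^+ 2.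
Proof.
rewrite /trunc_potential /trunc_force; set c := clip N x; set d := clip N y.
have cI : - N <= c <= N by exact: clip_itv.
have dI : - N <= d <= N by exact: clip_itv.
have dc : `|d - c| <= `|y - x| by exact: clip_lipschitz.
rewrite (_ : _ - _ = (W d - W c - w c * (d - c)) + (w d - w c) * (y - d)); last by ring.
have H1 : `|W d - W c - w c * (d - c)| <= 2 * L * `|y - x| ^+ 2.
  apply: (le_trans (W2 cI dI)); rewrite ler_wpM2l ?mulr_ge0//.
  by rewrite -real_normK ?num_real// ler_sqr ?nnegrE.
have H2 : `|(w d - w c) * (y - d)| <= L * `|y - x| ^+ 2.
  rewrite normrM; have [yd|yd|cd] := clip_defect x y N0.
  - by rewrite -/d in yd; rewrite yd subrr normr0 mulr0 mulr_ge0// exprn_ge0.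
  - rewrite expr2 mulrA; apply: ler_pM => //.
      by apply: (le_trans (wL dI cI)); rewrite ler_wpM2l.
    by rewrite [leRHS]distrC; exact: yd.
  - by rewrite /c /d cd subrr normr0 mul0r mulr_ge0// exprn_ge0.
apply: (le_trans (ler_normD _ _)); rewrite -[(y - x) ^+ 2]real_normK ?num_real//.
by lra.
Qed.

End truncation.

(** With [r] the cube root of [|x|], the product r^3 |z| is at most the fourth power of the larger
    of r and |z|. For |x| > 1 the power r^4 = |x|^(4/3) is at most |x|^q; for |x| <= 1 the summand 1
    suffices. *)
Lemma young_quartic (R : realType) (q x y z : R) : 4 / 3 <= q -> 0 <= y ->
  `|x| `^ q <= y -> `|x * z| <= 1 + y + z ^+ 4.
Proof.
move=> q43 y0 xqy; have z4 : z ^+ 4 = `|z| ^+ 4.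
  by rewrite -normrX ger0_norm// (@exprn_even_ge0 _ 4).
rewrite normrM z4; have [x1|x1] := leP `|x| 1.
  apply: (@le_trans _ _ `|z|); first by rewrite ler_piMl.
  have [z1|z1] := leP `|z| 1.
    have : 0 <= `|z| ^+ 4 by rewrite exprn_ge0.
    by lra.
  have : `|z| <= `|z| ^+ 4 by rewrite -[leLHS]expr1 ler_weXn2l// ltW.
  by lra.
pose r := `|x| `^ (3^-1).
have r0 : 0 <= r by exact: powR_ge0.
have r3 : r ^+ 3 = `|x|.
  by rewrite -powR_mulrn// -powRrM mulVf// powRr1.
have r4 : r ^+ 4 <= y.
  rewrite -powR_mulrn// -powRrM; apply: le_trans xqy.
  by apply: ler_powR; [exact: ltW|rewrite mulrC].
rewrite -r3; have [rz|zr] := leP `|z| r.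
  have : r ^+ 3 * `|z| <= r ^+ 3 * r by rewrite ler_wpM2l// exprn_ge0.
  have : 0 <= `|z| ^+ 4 by rewrite exprn_ge0.
  by rewrite -exprSr; lra.
have : r ^+ 3 * `|z| <= `|z| ^+ 3 * `|z|.
  by rewrite ler_wpM2r// lerXn2r ?nnegrE// ltW.
by rewrite -exprSr; lra.
Qed.

Lemma C1_lipschitz_itv (R : realType) (w : R -> R) (N : R) : 0 <= N ->
  (forall x, derivable w x 1) -> continuous (derive1 w) ->
  exists2 L, 0 <= L & forall x y, - N <= x <= N -> - N <= y <= N ->
    `|w x - w y| <= L * `|x - y|.
Proof.
move=> N0 dw cw.
have wc : continuous w.
  by move=> x; apply: differentiable_continuous; exact/derivable1_diffP.
have NN : - N <= N by lra.
have [|c _ cmax] := @EVT_max _ (fun x => `|derive1 w x|) (- N) N NN.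
  by apply: continuous_subspaceT => x; apply: cvg_norm; exact: cw.
exists `|derive1 w c| => //.
have ordered x y : - N <= x <= N -> - N <= y <= N -> x <= y ->
    `|w y - w x| <= `|derive1 w c| * `|y - x|.
  move=> /andP[xN _] /andP[_ yN] xy.
  have [||z] := @MVT_segment _ w (derive1 w) x y xy.
  - by move=> z _; rewrite derive1E; exact: derivableP.
  - exact: continuous_subspaceT.
  rewrite in_itv/= => /andP[xz zy] ->; rewrite normrM ler_wpM2r// cmax// in_itv/=.
  by apply/andP; lra.
move=> x y xN yN; have [xy|/ltW yx] := leP x y; last exact: ordered.
by rewrite distrC [X in _ * X]distrC; exact: ordered.
Qed.

(** * The equation with a Lipschitz force *)

Lemma locally_lipschitz_continuous (R : realType) (f : R -> R) :
  (forall x, exists c, forall y, `|y - x| <= 1 -> `|f y - f x| <= c * `|y - x|) ->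
  continuous f.
Proof.
move=> fl x; have [c fc] := fl x; apply/cvgrPdist_le => e e0.
pose c' := Num.max 1 c; have c'1 : 1 <= c' by rewrite le_max lexx.
have c'0 : 0 < c' by lra.
have d0 : 0 < Num.min 1 (e / c') by rewrite lt_min ltr01 divr_gt0.
near=> y; have : `|y - x| <= Num.min 1 (e / c').
  rewrite distrC; near: y; exact: cvgr_dist_le d0.
rewrite le_min => /andP[y1 ye]; rewrite distrC; apply: (le_trans (fc y y1)).
apply: (@le_trans _ _ (c' * `|y - x|)); first by rewrite ler_wpM2r// le_max lexx orbT.
by rewrite mulrC -ler_pdivlMr.
Unshelve. all: by end_near. Qed.

Section peridynamic.
Variable R : realType.
Notation mu := (@lebesgue_measure R).
Variables (a : R -> R) (A : R).
Hypothesis ma : measurable_fun setT a.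
Hypothesis a0 : forall x, 0 <= a x.
Hypothesis aN : forall x, a (- x) = a x.
Hypothesis aA : (\int[mu]_x (a x)%:E = A%:E)%E.

Let A0 : 0 <= A.
Proof. by rewrite -lee_fin -aA integral_ge0// => x _; rewrite lee_fin. Qed.

(** [w] is an argument because the same integral with a potential in its place is the potential part
    of the local energy. *)
Definition peri_force (w u : R -> R) (x : R) := \int[mu]_y (a (y - x) * w (u y - u x)).

Lemma measurable_peri_kernel (w u : R -> R) : measurable_fun setT w ->
  measurable_fun setT u ->
  measurable_fun setT (fun p : R * R => a (p.2 - p.1) * w (u p.2 - u p.1)).
Proof.
move=> mw mu_; apply: measurable_funM; first exact: measurable_kernel.
apply: measurableT_comp => //; apply: measurable_funB;
  exact: (measurableT_comp mu_).
Qed.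

Section lipschitz_force.
Variables (w : R -> R) (L : R).
Hypothesis L0 : 0 <= L.
Hypothesis wL : forall x y, `|w x - w y| <= L * `|x - y|.
Hypothesis w0 : w 0 = 0.

Lemma lipschitz_measurable : measurable_fun setT w.
Proof.
apply: continuous_measurable_fun; apply: locally_lipschitz_continuous => x.
by exists L => y _; exact: wL.
Qed.

Lemma gaugeX_norm (f : R -> R) (D : R) : gaugeX f D -> gaugeX (fun x => `|f x|) D.
Proof.
move=> [mf fD iD]; split; first exact: measurableT_comp.
  by move=> x; rewrite normr_id.
by under eq_integral do rewrite normr_id.
Qed.

Lemma lipschitz_kernel_dom (u : R -> R) x y :
  `|a (y - x) * w (u y - u x)| <= a (y - x) * (`|L * u y| + `|L * u x|).
Proof.
rewrite normrM ger0_norm// ler_wpM2l//.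
have := wL (u y - u x) 0; rewrite w0 !subr0 => /le_trans; apply.
by rewrite !normrM (ger0_norm L0) -mulrDr ler_wpM2l// ler_normB.
Qed.

Lemma peri_integrable u M x : gaugeX u M ->
  mu.-integrable setT (fun y => (a (y - x) * w (u y - u x))%:E).
Proof.
move=> uM; have mu_ : measurable_fun setT u by case: uM.
exact: (dominated_kernel_integrable ma a0 aA
  (measurable_peri_kernel lipschitz_measurable mu_) (lipschitz_kernel_dom u)
  (gauge_pZ (gaugeX_is_gauge R) L0 uM) x).
Qed.

Lemma peri_force_gaugeX u M : gaugeX u M -> gaugeX (peri_force w u) (2 * A * (L * M)).
Proof.
move=> uM; have mu_ : measurable_fun setT u by case: uM.
exact: (dominated_kernel_gaugeX ma a0 aN aA
  (measurable_peri_kernel lipschitz_measurable mu_) (lipschitz_kernel_dom u)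
  (gauge_pZ (gaugeX_is_gauge R) L0 uM)).
Qed.

Lemma peri_force_lipschitz u v M N D : gaugeX u M -> gaugeX v N ->
  gaugeX (fun x => u x - v x) D ->
  gaugeX (fun x => peri_force w u x - peri_force w v x) (2 * A * (L * D)).
Proof.
move=> uM vN uvD.
have mw := lipschitz_measurable.
have mu_ : measurable_fun setT u by case: uM.
have mv_ : measurable_fun setT v by case: vN.
pose k (p : R * R) := a (p.2 - p.1) * w (u p.2 - u p.1) -
                      a (p.2 - p.1) * w (v p.2 - v p.1).
have mk : measurable_fun setT k.
  exact: measurable_funB (measurable_peri_kernel mw mu_) (measurable_peri_kernel mw mv_).
have kg x y : `|k (x, y)| <= a (y - x) *
    (`|L * (u y - v y)| + `|L * (u x - v x)|).
  rewrite /k/= -mulrBr normrM ger0_norm// ler_wpM2l//.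
  apply: (le_trans (wL _ _)); rewrite !normrM (ger0_norm L0) -mulrDr ler_wpM2l//.
  by rewrite (_ : _ - _ = (u y - v y) - (u x - v x)) ?ler_normB//; ring.
have := dominated_kernel_gaugeX ma a0 aN aA mk kg
  (gauge_pZ (gaugeX_is_gauge R) L0 uvD).
congr gaugeX; apply/funext => x; rewrite /peri_force -RintegralB//.
- exact: peri_integrable uM.
- exact: peri_integrable vN.
Qed.

(** A pair of displacement ([false]) and velocity ([true]) is coded as one real function on
    [bool * R], so that the Euler scheme applies to the first-order system. *)
Definition gaugeXX (y : bool * R -> R) M := forall b, gaugeX (fun x => y (b, x)) M.

Lemma gaugeXX_is_gauge : is_gauge gaugeXX.
Proof.
have g := gaugeX_is_gauge R; split.
- by move=> b; exact: gauge0.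
- by move=> f M /(_ true); exact: gauge_ge0.
- by move=> f h M N fM hN b; exact: (gaugeD g (fM b) (hN b)).
- by move=> c f M fM b; exact: (gaugeZ g c (fM b)).
- by move=> f M N fM MN b; exact: (gauge_le g (fM b) MN).
- by move=> f M H b; apply: (gauge_closed g) => e e0; exact: (H e e0 b).
- move=> u M c u0 uc.
  have H b : exists l, forall n,
      gaugeX (fun x => l x - u n (b, x)) (2 * c / 2 ^+ n).
    exact: (gauge_complete g (u0 b) (fun n => uc n b)).
  have [l Hl] := choice H; exists (fun p => l p.1 p.2) => n b /=.
  exact: Hl.
Qed.

Definition peri_field (y : bool * R -> R) (p : bool * R) : R :=
  if p.1 then peri_force w (fun x => y (false, x)) p.2 else y (true, p.2).

(** The times [s] and [t] are not ordered, so that the expansions yield two-sided derivatives. *)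
Definition C2_bounds T (u v : R -> R -> R) C :=
  forall s t, 0 <= s <= T -> 0 <= t <= T ->
  [/\ gaugeX (u s) C, gaugeX (v s) C,
    gaugeX (fun x => u t x - u s x - (t - s) * v s x) (C * (t - s) ^+ 2) &
    gaugeX (fun x => v t x - v s x - (t - s) * peri_force w (u s) x)
      (C * (t - s) ^+ 2)].

Lemma peri_lipschitz_solution (phi psi : R -> R) M : gaugeX phi M -> gaugeX psi M ->
  exists u v : R -> R -> R, [/\ u 0 = phi, v 0 = psi &
    forall T, 0 <= T -> exists C, C2_bounds T u v C].
Proof.
move=> phiM psiM.
pose y0 (p : bool * R) := if p.1 then psi p.2 else phi p.2.
have y0M : gaugeXX y0 M by case.
pose Lf := 1 + 2 * A * L.
have AL : 0 <= 2 * A * L by rewrite !mulr_ge0.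
have Lf0 : 0 <= Lf by rewrite /Lf; lra.
have F0 : peri_field (fun=> 0) =1 fun=> 0.
  move=> [[] x]; rewrite /peri_field//= /peri_force.
  rewrite (eq_Rintegral _ (g := fun=> 0)) ?Rintegral_cst ?mul0r//.
  by move=> y _ /=; rewrite subrr w0 mulr0.
have FL y z My Mz D : gaugeXX y My -> gaugeXX z Mz ->
    gaugeXX (fun x => y x - z x) D ->
    gaugeXX (fun x => peri_field y x - peri_field z x) (Lf * D).
  move=> yM zM yzD; have D0 := gaugeX_ge0 (yzD true).
  case; rewrite /peri_field/=; last first.
    apply: (gauge_le (gaugeX_is_gauge R) (yzD true)).
    by rewrite /Lf mulrDl mul1r lerDl mulr_ge0.
  apply: (gauge_le (gaugeX_is_gauge R)
    (peri_force_lipschitz (yM false) (zM false) (yzD false))).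
  by rewrite /Lf; lra.
have [y yE yC] := euler_solution gaugeXX_is_gauge Lf0 F0 FL y0M.
exists (fun t x => y t (false, x)), (fun t x => y t (true, x)).
split=> [||T T0]; [by rewrite yE|by rewrite yE|].
have [C HC] := yC T T0; exists C => s t sT tT.
have [B1 B2] := HC s t sT tT.
by split; [exact: (B1 false)|exact: (B1 true)|exact: (B2 false)|exact: (B2 true)].
Qed.

End lipschitz_force.
End peridynamic.

(** * Energy estimates *)

Section energy.
Variable R : realType.
Notation mu := (@lebesgue_measure R).
Variables (a : R -> R) (A amax : R).
Hypothesis ma : measurable_fun setT a.
Hypothesis a0 : forall x, 0 <= a x.
Hypothesis aN : forall x, a (- x) = a x.
Hypothesis aA : (\int[mu]_x (a x)%:E = A%:E)%E.
Hypothesis amaxP : forall x, a x <= amax.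

Variables (w W : R -> R) (L Mw H : R).
Hypothesis L0 : 0 <= L.
Hypothesis wL : forall x y, `|w x - w y| <= L * `|x - y|.
Hypothesis w0 : w 0 = 0.
Hypothesis wN : forall x, w (- x) = - w x.
Hypothesis wM : forall x, `|w x| <= Mw.
Hypothesis H0 : 0 <= H.
Hypothesis W0 : W 0 = 0.
Hypothesis Wge0 : forall x, 0 <= W x.
Hypothesis W2 : forall x y, `|W y - W x - w x * (y - x)| <= H * (y - x) ^+ 2.

Let gX := gaugeX_is_gauge R.

Let A0 : 0 <= A.
Proof. by rewrite -lee_fin -aA integral_ge0// => x _; rewrite lee_fin. Qed.

Let Mw0 : 0 <= Mw. Proof. exact: le_trans (wM 0). Qed.

Let mw : measurable_fun setT w. Proof. exact: lipschitz_measurable wL. Qed.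

Lemma potential_measurable : measurable_fun setT W.
Proof.
apply: continuous_measurable_fun; apply: locally_lipschitz_continuous => x.
exists (`|w x| + H) => y yx1.
have e : W y - W x = (W y - W x - w x * (y - x)) + w x * (y - x) by ring.
rewrite e (le_trans (ler_normD _ _))// normrM mulrDl addrC lerD2l.
apply: (le_trans (W2 x y)); rewrite ler_wpM2l//.
by rewrite -real_normK ?num_real// expr2 ler_piMl.
Qed.

Notation force := (peri_force a w).
Notation energy := (peri_force a W).
Definition peri_power (u v : R -> R) x :=
  \int[mu]_y (a (y - x) * w (u y - u x) * v y).

(** The expansion of [W] at 0 bounds it by H eta^2; one factor |eta| is at most [2 * M], which
    leaves a bound linear in [u]. *)
Lemma energy_kernel_dom u M x y : gaugeX u M ->
  `|a (y - x) * W (u y - u x)| <=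
    a (y - x) * (`|H * (2 * M) * u y| + `|H * (2 * M) * u x|).
Proof.
move=> uM; have M0 := gaugeX_ge0 uM; have [_ uM' _] := uM.
rewrite normrM ger0_norm// ler_wpM2l//.
have := W2 0 (u y - u x); rewrite w0 W0 mul0r !subr0 => /le_trans; apply.
rewrite !(normrM (H * (2 * M))) !(ger0_norm (mulr_ge0 H0 (mulr_ge0 _ M0)))//.
rewrite -mulrDr -mulrA ler_wpM2l// -real_normK ?num_real// expr2.
have uu := ler_normB (u y) (u x); apply: ler_pM => //.
by have := uM' y; have := uM' x; lra.
Qed.

Lemma energy_integrable u M x : gaugeX u M ->
  mu.-integrable setT (fun y => (a (y - x) * W (u y - u x))%:E).
Proof.
move=> uM; have mu_ : measurable_fun setT u by case: uM.
have HM : 0 <= H * (2 * M) by rewrite !mulr_ge0// (gaugeX_ge0 uM).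
exact: (dominated_kernel_integrable ma a0 aA
  (measurable_peri_kernel ma potential_measurable mu_)
  (fun x y => energy_kernel_dom x y uM) (gauge_pZ gX HM uM) x).
Qed.

Lemma energy_gaugeX u M : gaugeX u M ->
  gaugeX (energy u) (2 * A * (H * (2 * M) * M)).
Proof.
move=> uM; have mu_ : measurable_fun setT u by case: uM.
have HM : 0 <= H * (2 * M) by rewrite !mulr_ge0// (gaugeX_ge0 uM).
exact: (dominated_kernel_gaugeX ma a0 aN aA
  (measurable_peri_kernel ma potential_measurable mu_)
  (fun x y => energy_kernel_dom x y uM) (gauge_pZ gX HM uM)).
Qed.

Lemma energy_ge0 u x : 0 <= energy u x.
Proof. by apply: Rintegral_ge0 => y _; rewrite mulr_ge0. Qed.

Lemma power_kernel_dom (u v : R -> R) x y :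
  `|a (y - x) * w (u y - u x) * v y| <= a (y - x) * (`|Mw * v y| + `|Mw * v x|).
Proof.
rewrite 2!normrM ger0_norm// -mulrA ler_wpM2l// !normrM (ger0_norm Mw0).
apply: (@le_trans _ _ (Mw * `|v y|)); first by rewrite ler_wpM2r.
by rewrite lerDl mulr_ge0.
Qed.

Lemma measurable_power_kernel (u v : R -> R) : measurable_fun setT u ->
  measurable_fun setT v ->
  measurable_fun setT (fun p : R * R => a (p.2 - p.1) * w (u p.2 - u p.1) * v p.2).
Proof.
move=> mu_ mv_; apply: measurable_funM; first exact: (measurable_peri_kernel ma mw mu_).
exact: (measurableT_comp mv_).
Qed.

Lemma power_integrable u v M N x : gaugeX u M -> gaugeX v N ->
  mu.-integrable setT (fun y => (a (y - x) * w (u y - u x) * v y)%:E).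
Proof.
move=> [mu_ _ _] vN; have mv_ : measurable_fun setT v by case: vN.
exact: (dominated_kernel_integrable ma a0 aA (measurable_power_kernel mu_ mv_)
  (power_kernel_dom u v) (gauge_pZ gX Mw0 vN) x).
Qed.

Lemma power_gaugeX u v M N : gaugeX u M -> gaugeX v N ->
  gaugeX (peri_power u v) (2 * A * (Mw * N)).
Proof.
move=> [mu_ _ _] vN; have mv_ : measurable_fun setT v by case: vN.
exact: (dominated_kernel_gaugeX ma a0 aN aA (measurable_power_kernel mu_ mv_)
  (power_kernel_dom u v) (gauge_pZ gX Mw0 vN)).
Qed.

Lemma force_integrable u M x : gaugeX u M ->
  mu.-integrable setT (fun y => (a (y - x) * w (u y - u x))%:E).
Proof. exact: (peri_integrable ma a0 aA L0 wL w0). Qed.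

(* Evenness of [a] and oddness of [w] make the pairwise force antisymmetric, so
   exchanging [x] and [y] turns the power received into minus the power spent. *)
Lemma integral_power u v M N : gaugeX u M -> gaugeX v N ->
  \int[mu]_x peri_power u v x = - \int[mu]_x (v x * force u x).
Proof.
move=> uM vN; have [mu_ _ _] := uM; have [mv_ vN' _] := vN.
rewrite (dominated_kernel_swap ma a0 aN aA (measurable_power_kernel mu_ mv_)
  (power_kernel_dom u v) (gauge_pZ gX Mw0 vN)).
rewrite -mulN1r -RintegralZl//; last first.
  exact: gaugeX_integrable (gaugeX_mul
    (peri_force_gaugeX ma a0 aN aA L0 wL w0 uM) mv_ vN').
apply: eq_Rintegral => x _ /=; rewrite /peri_force mulrA -RintegralZl//; last first.
  exact: force_integrable uM.
apply: eq_Rintegral => y _ /=.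
by rewrite -(aN (x - y)) opprB -(opprB (u y)) wN; ring.
Qed.

(** The rate of the integral of a W is the integral of a w (v(y) - v(x)), that is, the power minus
    [v x * force u x]; the latter cancels the rate of the kinetic energy. In the remainder, the
    square of an increment of u(y) - u(x) gives up one factor [2 * E], and the bounded [w]
    multiplies the defect [D] of the displacement. *)
Lemma energy_second_order u u' v M M' N h D E :
  gaugeX u M -> gaugeX u' M' -> gaugeX v N ->
  gaugeX (fun x => u' x - u x - h * v x) D -> gaugeX (fun x => u' x - u x) E ->
  gaugeX (fun x => energy u' x - energy u x -
                   h * (peri_power u v x - v x * force u x))
    (2 * A * (H * (2 * E) * E + Mw * D)).
Proof.
move=> uM u'M vN duD duE.
have [mu_ _ _] := uM; have [mu'_ _ _] := u'M; have [mv_ _ _] := vN.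
have E0 := gaugeX_ge0 duE; have HE : 0 <= H * (2 * E) by rewrite !mulr_ge0.
pose k (p : R * R) := a (p.2 - p.1) * W (u' p.2 - u' p.1) -
  a (p.2 - p.1) * W (u p.2 - u p.1) -
  h * (a (p.2 - p.1) * w (u p.2 - u p.1) * v p.2 -
       v p.1 * (a (p.2 - p.1) * w (u p.2 - u p.1))).
have mW := potential_measurable.
have mk : measurable_fun setT k.
  apply: measurable_funB.
    exact: measurable_funB (measurable_peri_kernel ma mW mu'_)
      (measurable_peri_kernel ma mW mu_).
  apply: measurable_funM => //; apply: measurable_funB.
    exact: measurable_power_kernel.
  apply: measurable_funM; first exact: (measurableT_comp mv_).
  exact: (measurable_peri_kernel ma mw mu_).
pose g x := H * (2 * E) * `|u' x - u x| + Mw * `|u' x - u x - h * v x|.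
have gD : gaugeX g (H * (2 * E) * E + Mw * D).
  apply: (gaugeD gX); apply: (gauge_pZ gX) => //; exact: gaugeX_norm.
have g0 x : 0 <= g x by rewrite addr_ge0// mulr_ge0.
have kg x y : `|k (x, y)| <= a (y - x) * (`|g y| + `|g x|).
  rewrite (ger0_norm (g0 x)) (ger0_norm (g0 y)) /k/=.
  set eta' := u' y - u' x; set eta := u y - u x.
  rewrite (_ : _ - _ = a (y - x) * ((W eta' - W eta - w eta * (eta' - eta)) +
    w eta * ((u' y - u y - h * v y) - (u' x - u x - h * v x)))); last first.
    by rewrite /eta /eta'; ring.
  rewrite normrM ger0_norm// ler_wpM2l//.
  apply: (le_trans (ler_normD _ _)); rewrite normrM.
  have [_ dE _] := duE.
  have H1 : `|W eta' - W eta - w eta * (eta' - eta)| <=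
      H * (2 * E) * (`|u' y - u y| + `|u' x - u x|).
    apply: (le_trans (W2 _ _)); rewrite -mulrA ler_wpM2l//.
    rewrite (_ : eta' - eta = (u' y - u y) - (u' x - u x)); last first.
      by rewrite /eta /eta'; ring.
    have uu := ler_normB (u' y - u y) (u' x - u x).
    rewrite -real_normK ?num_real// expr2; apply: ler_pM => //.
    by have := dE y; have := dE x; lra.
  have H2 := ler_pM (normr_ge0 _) (normr_ge0 _) (wM eta)
    (ler_normB (u' y - u y - h * v y) (u' x - u x - h * v x)).
  by rewrite /g; lra.
have := dominated_kernel_gaugeX ma a0 aN aA mk kg gD.
congr gaugeX; apply/funext => x.
have i1 := energy_integrable x u'M; have i2 := energy_integrable x uM.
have i3 := power_integrable x uM vN; have i4 := force_integrable x uM.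
have i4' : mu.-integrable setT (EFin \o fun y => v x * (a (y - x) * w (u y - u x))).
  exact: (integrableZl measurableT (v x) i4).
have i5 : mu.-integrable setT (EFin \o fun y =>
    a (y - x) * w (u y - u x) * v y - v x * (a (y - x) * w (u y - u x))).
  exact: (integrableB measurableT i3 i4').
have i6 : mu.-integrable setT (EFin \o fun y => h *
    (a (y - x) * w (u y - u x) * v y - v x * (a (y - x) * w (u y - u x)))).
  exact: (integrableZl measurableT h i5).
have i7 : mu.-integrable setT (EFin \o fun y =>
    a (y - x) * W (u' y - u' x) - a (y - x) * W (u y - u x)).
  exact: (integrableB measurableT i1 i2).
rewrite /k/= RintegralB// RintegralB// RintegralZl// RintegralB// RintegralZl//.
Qed.

Lemma kinetic_second_order (v v' k : R -> R) N h D E : gaugeX v N ->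
  gaugeX (fun x => v' x - v x - h * k x) D -> gaugeX (fun x => v' x - v x) E ->
  gaugeX (fun x => v' x ^+ 2 / 2 - v x ^+ 2 / 2 - h * (v x * k x))
    (N * D + E * E / 2).
Proof.
move=> [mv_ vN _] dD dE; have [mE EE _] := dE.
have H1 := gaugeX_mul dD mv_ vN; have H2 := gaugeX_mul dE mE EE.
have h2 : 0 <= 2^-1 :> R by rewrite invr_ge0.
apply: (gauge_eq gX (gaugeD gX H1 (gauge_pZ gX h2 H2))) => [x|]; last by lra.
by field.
Qed.

Section bounds.
Variables (T C : R) (u v : R -> R -> R).
Hypothesis uvC : C2_bounds a w T u v C.
Let T_ge0 t : 0 <= t <= T -> 0 <= T. Proof. by move=> /andP[]; exact: le_trans. Qed.

Lemma energy_defect : exists C', forall s t, 0 <= s <= T -> 0 <= t <= T ->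
  gaugeX (fun x => v t x ^+ 2 / 2 - v s x ^+ 2 / 2 - (t - s) * (v s x * force (u s) x))
    (C' * (t - s) ^+ 2) /\
  gaugeX (fun x => energy (u t) x - energy (u s) x -
      (t - s) * (peri_power (u s) (v s) x - v s x * force (u s) x))
    (C' * (t - s) ^+ 2).
Proof.
(* [E1 * |t - s|] bounds the increments of both [u] and [v]: 1 and [2 * A * L] come from the linear
   terms, [T] from the quadratic remainder. *)
pose E1 := C * (T + 1 + 2 * A * L).
pose C1 := C * C + E1 ^+ 2 / 2; pose C2 := 2 * A * (H * (2 * E1) * E1 + Mw * C).
exists (`|C1| + `|C2|) => s t sT tT.
have [us vs du dv] := uvC sT tT; have [ut vt _ _] := uvC tT sT.
have C0 := gaugeX_ge0 us; have T0 := T_ge0 sT.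
have AL0 : 0 <= 2 * A * L by rewrite !mulr_ge0.
set h := t - s in du dv *.
have hT : `|h| <= T by rewrite /h ler_norml; lra.
have h2 : h ^+ 2 = `|h| ^+ 2 by rewrite real_normK ?num_real.
have h2T : C * h ^+ 2 <= C * T * `|h|.
  by rewrite h2 expr2 mulrA ler_wpM2r// ler_wpM2l.
have hC0 : 0 <= C * `|h| by rewrite mulr_ge0.
have fs := peri_force_gaugeX ma a0 aN aA L0 wL w0 us.
have eu : gaugeX (fun x => u t x - u s x) (E1 * `|h|).
  apply: (gauge_eq gX (gaugeD gX du (gaugeZ gX h vs))) => [x|]; first by ring.
  have : 0 <= 2 * A * L * (C * `|h|) by rewrite mulr_ge0.
  by rewrite /E1; lra.
have ev : gaugeX (fun x => v t x - v s x) (E1 * `|h|).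
  apply: (gauge_eq gX (gaugeD gX dv (gaugeZ gX h fs))) => [x|]; first by ring.
  by rewrite /E1; lra.
have hh : 0 <= h ^+ 2 by exact: sqr_ge0.
split.
  apply: (gauge_le gX (kinetic_second_order vs dv ev)).
  apply: (@le_trans _ _ (C1 * h ^+ 2)); last first.
    by rewrite ler_wpM2r// (le_trans (ler_norm _))// lerDl.
  by rewrite /C1 h2; lra.
apply: (gauge_le gX (energy_second_order us ut vs du eu)).
apply: (@le_trans _ _ (C2 * h ^+ 2)); last first.
  by rewrite ler_wpM2r// (le_trans (ler_norm _))// lerDr.
by rewrite /C2 h2; lra.
Qed.

Definition total_energy t := \int[mu]_x (v t x ^+ 2 / 2 + energy (u t) x / 2).

Let kinetic_gaugeX t : 0 <= t <= T -> gaugeX (fun x => v t x ^+ 2 / 2) (C * C / 2).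
Proof.
move=> tT; have [_ vt _ _] := uvC tT tT; have [mv_ vC _] := vt.
have h2 : 0 <= 2^-1 :> R by rewrite invr_ge0.
apply: (gauge_eq gX (gauge_pZ gX h2 (gaugeX_mul vt mv_ vC))) => [x|].
  by rewrite mulrC.
by rewrite mulrC.
Qed.

Let potential_gaugeX t : 0 <= t <= T ->
  gaugeX (fun x => energy (u t) x / 2) (2 * A * (H * (2 * C) * C) / 2).
Proof.
move=> tT; have [ut _ _ _] := uvC tT tT.
have h2 : 0 <= 2^-1 :> R by rewrite invr_ge0.
by apply: (gauge_eq gX (gauge_pZ gX h2 (energy_gaugeX ut))) => [x|]; rewrite mulrC.
Qed.

Lemma total_energy_second_order : exists C', 0 <= C' /\
  forall s t, 0 <= s <= T -> 0 <= t <= T ->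
  total_energy t <= total_energy s + C' * (t - s) ^+ 2.
Proof.
have [C' HC'] := energy_defect; exists (`|C'| + `|C'| / 2); split.
  by have := normr_ge0 C'; lra.
move=> s t sT tT; have [K P] := HC' s t sT tT.
have [us vs _ _] := uvC sT tT; have [mv_ vC _] := vs.
have h2 : 0 <= 2^-1 :> R by rewrite invr_ge0.
have fs := gaugeX_mul (peri_force_gaugeX ma a0 aN aA L0 wL w0 us) mv_ vC.
have ps := power_gaugeX us vs.
set h := t - s in K P *.
(* With half the potential, the rate of the energy density is [F / 2]: half of [v * force] survives
   and meets half of the power. The integral of [F] is zero by [integral_power]. *)
pose F x := v s x * force (u s) x + peri_power (u s) (v s) x.
pose e r x := v r x ^+ 2 / 2 + energy (u r) x / 2.
have H1 : gaugeX (fun x => e t x - e s x - h / 2 * F x)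
    (C' * h ^+ 2 + 2^-1 * (C' * h ^+ 2)).
  apply: (gauge_eq gX (gaugeD gX K (gauge_pZ gX h2 P))) => // x.
  by rewrite /e /F; field.
have ie r : 0 <= r <= T -> mu.-integrable setT (EFin \o e r).
  move=> rT; exact: gaugeX_integrable (gaugeD gX (kinetic_gaugeX rT) (potential_gaugeX rT)).
have iF : mu.-integrable setT (EFin \o F) by exact: gaugeX_integrable (gaugeD gX fs ps).
have F0 : \int[mu]_x F x = 0.
  rewrite RintegralD//; last 2 first.
  - exact: gaugeX_integrable fs.
  - exact: gaugeX_integrable ps.
  by rewrite (integral_power us vs) subrr.
have ihF : mu.-integrable setT (EFin \o (fun x => h / 2 * F x)).
  exact: (integrableZl measurableT (h / 2) iF).
have ites : mu.-integrable setT (EFin \o (fun x => e t x - e s x)).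
  exact: (integrableB measurableT (ie t tT) (ie s sT)).
have := gaugeX_Rintegral H1.
rewrite RintegralB// RintegralB//; [|exact: ie|exact: ie].
rewrite RintegralZl// F0 mulr0 subr0 -/(total_energy t) -/(total_energy s).
move: (total_energy t) (total_energy s) => et es.
rewrite ler_norml => /andP[_].
have : C' * h ^+ 2 <= `|C'| * h ^+ 2 by rewrite ler_wpM2r ?sqr_ge0// ler_norm.
by lra.
Qed.

Lemma total_energy_le t : 0 <= t <= T -> total_energy t <= total_energy 0.
Proof.
move=> tT; have [C' [C'0 HC']] := total_energy_second_order.
have [t0 t1] := andP tT.
(* The energy is measured from its initial value so that Gronwall starts at 0 with zero rates; only
   the vanishing remainder is left. *)
pose P s r := total_energy s - total_energy 0 <= r.
have PM s r r' : P s r -> r <= r' -> P s r' by exact: le_trans.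
have P0 : P 0 0 by rewrite /P subrr.
have Pstep s s' r : 0 <= s -> s <= s' -> s' <= T -> 0 <= r -> P s r ->
    P s' (r + (s' - s) * (0 + 0 * r) + C' * (s' - s) ^+ 2).
  move=> s0 ss' s'T _; rewrite /P => Ps.
  have := HC' s s' _ _; rewrite s0 (le_trans ss' s'T) s'T (le_trans s0 ss').
  move=> /(_ erefl erefl).
  move: (total_energy s') (total_energy s) (total_energy 0) Ps => x y z Ps H1.
  by lra.
apply/ler_addgt0Pr => e e0.
have := discrete_gronwall (lexx 0) (lexx 0) C'0 (lexx 0) PM Pstep P0 tT e0.
rewrite /P; move: (total_energy t) (total_energy 0) => x y.
by rewrite !mul0r addr0 mul0r; lra.
Qed.

Lemma kinetic_energy_le t : 0 <= t <= T ->
  \int[mu]_x (v t x ^+ 2) <= 2 * total_energy 0.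
Proof.
move=> tT; have it := gaugeX_integrable (kinetic_gaugeX tT).
have ip := gaugeX_integrable (potential_gaugeX tT).
have -> : \int[mu]_x (v t x ^+ 2) = 2 * \int[mu]_x (v t x ^+ 2 / 2).
  by rewrite -RintegralZl//; apply: eq_Rintegral => x _; rewrite mulrC divfK.
rewrite ler_pM2l//; apply: le_trans (total_energy_le tT).
rewrite /total_energy RintegralD// lerDl; apply: Rintegral_ge0 => x _.
by rewrite divr_ge0// energy_ge0.
Qed.

Variables (Cw M Gam : R).
Hypothesis Cw0 : 0 <= Cw.
Hypothesis wW : forall x z, `|w x * z| <= 1 + Cw * W x + z ^+ 4.
Hypothesis v0M : gaugeX (v 0) M.
Hypothesis u0G : gaugeX (energy (u 0)) Gam.

Let E0 := M ^+ 2 / 2 + Gam / 2.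

Let total_energy0_le : total_energy 0 <= E0.
Proof.
have [mv_ vM _] := v0M.
have h2 : 0 <= 2^-1 :> R by rewrite invr_ge0.
have H1 := gaugeD gX (gauge_pZ gX h2 (gaugeX_mul v0M mv_ vM)) (gauge_pZ gX h2 u0G).
have := gaugeX_Rintegral H1.
rewrite ler_norml => /andP[_]; rewrite /total_energy => H2.
rewrite (eq_Rintegral mu (g := fun x => 2^-1 * (v 0 x * v 0 x) + 2^-1 * energy (u 0) x)).
  by rewrite /E0; apply: (le_trans H2); lra.
by move=> x _; rewrite expr2; lra.
Qed.

(* The quartic term of [wW] is what limits the growth of the local energy to a
   linear differential inequality: [v ^+ 4 <= sup v ^+ 2 * v ^+ 2], and the
   integral of [v ^+ 2] is controlled by the total energy. *)
Lemma power_le t r x : 0 <= t <= T -> (forall y, v t y ^+ 2 <= 2 * r) -> 0 <= r ->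
  peri_power (u t) (v t) x <= A + Cw * energy (u t) x + 4 * amax * E0 * r.
Proof.
move=> tT vr r0; have [ut vt _ _] := uvC tT tT; have [mv_ vC _] := vt.
have am0 : 0 <= amax by exact: le_trans (amaxP 0).
pose p1 y := a (y - x); pose p2 y := Cw * (a (y - x) * W (u t y - u t x)).
pose p3 y := amax * (2 * r) * v t y ^+ 2.
have ip1 : mu.-integrable setT (EFin \o p1).
  apply/integrableP; split.
    by apply/measurable_EFinP; exact: measurable_shift_kernel.
  rewrite (_ : (\int[mu]_y _)%E = A%:E) ?ltry// -(integral_kernel ma a0 aA x).
  by apply: eq_integral => y _; rewrite /= ger0_norm// /p1.
have ip2' := energy_integrable x ut.
have ip2 : mu.-integrable setT (EFin \o p2) by exact: (integrableZl measurableT Cw ip2').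
have ip3' : mu.-integrable setT (EFin \o (fun y => v t y ^+ 2)).
  exact: gaugeX_integrable (gaugeX_mul vt mv_ vC).
have ip3 : mu.-integrable setT (EFin \o p3).
  exact: (integrableZl measurableT (amax * (2 * r)) ip3').
have ip12 : mu.-integrable setT (EFin \o (fun y => p1 y + p2 y)).
  exact: (integrableD measurableT ip1 ip2).
apply: (@le_trans _ _ (\int[mu]_y (p1 y + p2 y + p3 y))).
  apply: le_Rintegral => //; first exact: power_integrable ut vt.
    exact: (integrableD measurableT ip12 ip3).
  move=> y _; rewrite /p1 /p2 /p3 -mulrA.
  apply: (@le_trans _ _ (a (y - x) * (1 + Cw * W (u t y - u t x) + v t y ^+ 4))).
    by rewrite ler_wpM2l// (le_trans (ler_norm _)).
  rewrite (_ : 4%N = (2 * 2)%N)// exprM.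
  have v2 := sqr_ge0 (v t y).
  have q1 : a (y - x) * (v t y ^+ 2) ^+ 2 <= amax * ((2 * r) * v t y ^+ 2).
    apply: ler_pM => //; first exact: sqr_ge0.
    by rewrite expr2; apply: ler_pM.
  by lra.
rewrite RintegralD// RintegralD// RintegralZl// RintegralZl//.
have -> : \int[mu]_y p1 y = A.
  by rewrite /Rintegral (integral_kernel ma a0 aA).
(* The factor 4 is the 2 of [v ^+ 2 <= 2 * r] times the 2 of the kinetic bound [2 * E0]. *)
have ke := le_trans (kinetic_energy_le tT)
  (ler_wpM2l (ler0n R 2) total_energy0_le).
rewrite lerD2l.
have amr : 0 <= amax * (2 * r) by rewrite !mulr_ge0.
by have := ler_wpM2l amr ke; lra.
Qed.

(** None of [L], [Mw], [H] and [C] enters the bound, so it is the same for all truncation levels.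
    The inner [+ 1] is the slack of Gronwall's inequality; the outer 1 covers [|v t x| <= 1], since
    otherwise [|v t x|] is at most its square. *)
Lemma velocity_bound t x : 0 <= t <= T -> `|v t x| <=
  1 + 2 * ((M ^+ 2 / 2 + Gam + A * T) * expR ((Cw + 4 * amax * E0) * T) + 1).
Proof.
move=> tT; have [C' HC'] := energy_defect.
have M0 := gaugeX_ge0 v0M; have G0 := gaugeX_ge0 u0G.
have am0 : 0 <= amax by exact: le_trans (amaxP 0).
have M20 : 0 <= M ^+ 2 by exact: sqr_ge0.
have E00 : 0 <= E0 by rewrite /E0; lra.
have AE0 : 0 <= 4 * amax * E0 by rewrite !mulr_ge0.
set B := Cw + _; have B0 : 0 <= B by rewrite addr_ge0.
pose P s r := forall x, v s x ^+ 2 / 2 + energy (u s) x <= r.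
have C0 : 0 <= 2 * `|C'| by rewrite mulr_ge0.
have r00 : 0 <= M ^+ 2 / 2 + Gam by lra.
have PM s r r' : P s r -> r <= r' -> P s r'.
  by move=> H1 rr' y; exact: le_trans (H1 y) rr'.
have P0 : P 0 (M ^+ 2 / 2 + Gam).
  move=> y; have [_ /(_ y) vM _] := v0M; have [_ /(_ y) uG _] := u0G.
  have : v 0 y ^+ 2 <= M ^+ 2.
    by rewrite -real_normK ?num_real// ler_sqr ?nnegrE.
  by have := le_trans (ler_norm _) uG; lra.
have Pstep s t' r : 0 <= s -> s <= t' -> t' <= T -> 0 <= r -> P s r ->
    P t' (r + (t' - s) * (A + B * r) + 2 * `|C'| * (t' - s) ^+ 2).
  move=> s0 st t'T r0 Ps y.
  have sT : 0 <= s <= T by rewrite s0 (le_trans st).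
  have t'I : 0 <= t' <= T by rewrite (le_trans s0 st).
  have [[_ K _] [_ E _]] := HC' s t' sT t'I.
  have vr z : v s z ^+ 2 <= 2 * r.
    by have := Ps z; have := energy_ge0 (u s) z; lra.
  have pw := power_le y sT vr r0.
  have er : energy (u s) y <= r.
    by have := Ps y; have := sqr_ge0 (v s y); lra.
  have cer := ler_wpM2l Cw0 er.
  have ts0 : 0 <= t' - s by rewrite subr_ge0.
  have pw' : peri_power (u s) (v s) y <= A + B * r.
    by apply: (le_trans pw); rewrite /B; lra.
  have tpw := ler_wpM2l ts0 pw'.
  have := Ps y; have := le_trans (ler_norm _) (K y).
  have := le_trans (ler_norm _) (E y).
  have : C' * (t' - s) ^+ 2 <= `|C'| * (t' - s) ^+ 2.
    by rewrite ler_wpM2r ?sqr_ge0// ler_norm.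
  (* Adding the kinetic and the potential expansion cancels [v * force]; the power is what remains,
     and [tpw] bounds it. *)
  move: (energy (u t') y) (energy (u s) y) (peri_power _ _ _) (force _ _) tpw => ? ? ? ? ?.
  by lra.
have := discrete_gronwall A0 B0 C0 r00 PM Pstep P0 tT ltr01.
move=> /(_ x) Pt; have [t0 t1] := andP tT.
have ex : expR (B * t) <= expR (B * T) by rewrite ler_expR ler_wpM2l.
have At : A * t <= A * T by rewrite ler_wpM2l.
have At0 : 0 <= A * t by rewrite mulr_ge0.
have := ler_pM (addr_ge0 r00 At0) (expR_ge0 _) (lerD (lexx (M ^+ 2 / 2 + Gam)) At) ex.
have : 0 <= (M ^+ 2 / 2 + Gam + A * T) * expR (B * T).
  by rewrite mulr_ge0 ?expR_ge0//; lra.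
move: (_ * expR (B * T)) (_ * expR (B * t)) Pt => Q Qt Pt Q0 QQ.
have eg := energy_ge0 (u t) x; move: (energy _ _) Pt eg => en Pt eg.
have v2 : v t x ^+ 2 <= 2 * (Q + 1) by lra.
have [vl|vg] := leP `|v t x| 1; first by lra.
have : `|v t x| <= v t x ^+ 2.
  by rewrite -real_normK ?num_real// expr2 ler_peMl// ltW.
by lra.
Qed.

End bounds.

End energy.

(** * Uniqueness and a priori bounds *)

Section uniqueness.
Variable R : realType.
Notation mu := (@lebesgue_measure R).
Variables (a : R -> R) (A : R).
Hypothesis ma : measurable_fun setT a.
Hypothesis a0 : forall x, 0 <= a x.
Hypothesis aN : forall x, a (- x) = a x.
Hypothesis aA : (\int[mu]_x (a x)%:E = A%:E)%E.

Let A0 : 0 <= A.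
Proof. by rewrite -lee_fin -aA integral_ge0// => x _; rewrite lee_fin. Qed.
Let gX := gaugeX_is_gauge R.

Lemma C2_bounds_le (w : R -> R) T T' u v C : T' <= T ->
  C2_bounds a w T u v C -> C2_bounds a w T' u v C.
Proof. by move=> TT uv s t /andP[s0 sT] /andP[t0 tT]; apply: uv; lra. Qed.

Lemma C2_bounds_unique_lipschitz (w : R -> R) L T u v C u' v' C' :
  0 <= L -> (forall x y, `|w x - w y| <= L * `|x - y|) -> w 0 = 0 ->
  C2_bounds a w T u v C -> C2_bounds a w T u' v' C' ->
  u 0 = u' 0 -> v 0 = v' 0 ->
  forall t, 0 <= t <= T -> u t = u' t /\ v t = v' t.
Proof.
move=> L0 wL w0 uvC uvC' u0 v0 t tT.
have AL0 : 0 <= 2 * A * L by rewrite !mulr_ge0.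
have [t0 tT'] := andP tT; have T0 := le_trans t0 tT'.
have I0 : (0 : R) <= 0 <= T by rewrite lexx.
have C0 : 0 <= C by have [/gaugeX_ge0] := uvC 0 0 I0 I0.
have C'0 : 0 <= C' by have [/gaugeX_ge0] := uvC' 0 0 I0 I0.
pose P s r := gaugeX (fun x => u s x - u' s x) r /\ gaugeX (fun x => v s x - v' s x) r.
have PM s r r' : P s r -> r <= r' -> P s r'.
  by move=> [P1 P2] rr'; split; exact: (gauge_le gX _ rr').
have P0 : P 0 0.
  by rewrite /P u0 v0; split; apply: (gauge_eq gX (gauge0 gX)) => // x; rewrite subrr.
have Pstep s t' r : 0 <= s -> s <= t' -> t' <= T -> 0 <= r -> P s r ->
    P t' (r + (t' - s) * (0 + (1 + 2 * A * L) * r) + (C + C') * (t' - s) ^+ 2).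
  move=> s0 st t'T r0 [P1 P2].
  have sI : 0 <= s <= T by rewrite s0 (le_trans st).
  have tI : 0 <= t' <= T by rewrite (le_trans s0 st).
  have [us vs du dv] := uvC s t' sI tI; have [us' vs' du' dv'] := uvC' s t' sI tI.
  have h0 : 0 <= t' - s by rewrite subr_ge0.
  have K := peri_force_lipschitz ma a0 aN aA L0 wL w0 us us' P1.
  have hr : 0 <= (t' - s) * r by rewrite mulr_ge0.
  have hALr : 0 <= (t' - s) * (2 * A * L * r) by rewrite !mulr_ge0.
  split.
    apply: (gauge_eq gX (gaugeD gX (gaugeD gX P1 (gauge_pZ gX h0 P2))
      (gaugeB gX du du'))) => [x|]; [by ring|by lra].
  apply: (gauge_eq gX (gaugeD gX (gaugeD gX P2 (gauge_pZ gX h0 K))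
    (gaugeB gX dv dv'))) => [x|]; [by ring|by lra].
have B0 : 0 <= 1 + 2 * A * L by lra.
have Pe e : 0 < e -> P t e.
  move=> e0; have := discrete_gronwall (lexx 0) B0 (addr_ge0 C0 C'0) (lexx 0)
    PM Pstep P0 tT e0.
  by rewrite !(mul0r, add0r, addr0).
have zero f : (forall e, 0 < e -> gaugeX f e) -> forall x : R, f x = 0.
  move=> H x; have [_ /(_ x) f0 _] : gaugeX f 0.
    by apply: (gauge_closed gX) => e e0; rewrite add0r; exact: H.
  by apply/eqP; rewrite -normr_eq0 eq_le normr_ge0 f0.
split; apply/funext => x; apply/eqP; rewrite -subr_eq0; apply/eqP.
  exact: (zero _ (fun e e0 => (Pe e e0).1) x).
exact: (zero _ (fun e e0 => (Pe e e0).2) x).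
Qed.

Lemma displacement_bound (w : R -> R) T u v C M V : C2_bounds a w T u v C ->
  (forall x, `|u 0 x| <= M) ->
  (forall t, 0 <= t <= T -> forall x, `|v t x| <= V) ->
  forall t x, 0 <= t <= T -> `|u t x| <= M + V * T + 1.
Proof.
move=> uvC u0M vV t x tT; have [t0 tT'] := andP tT; have T0 := le_trans t0 tT'.
have I0 : (0 : R) <= 0 <= T by rewrite lexx.
have C0 : 0 <= C by have [/gaugeX_ge0] := uvC 0 0 I0 I0.
have V0 : 0 <= V by exact: le_trans (vV 0 I0 0).
have M0 : 0 <= M by exact: le_trans (u0M 0).
pose P s r := `|u s x| <= r.
have PM s r r' : P s r -> r <= r' -> P s r' by exact: le_trans.
have Pstep s t' r : 0 <= s -> s <= t' -> t' <= T -> 0 <= r -> P s r ->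
    P t' (r + (t' - s) * (V + 0 * r) + C * (t' - s) ^+ 2).
  move=> s0 st t'T r0 Ps.
  have sI : 0 <= s <= T by rewrite s0 (le_trans st).
  have tI : 0 <= t' <= T by rewrite (le_trans s0 st).
  have [_ _ [_ /(_ x) du _] _] := uvC s t' sI tI.
  have h0 : 0 <= t' - s by rewrite subr_ge0.
  have hv : `|(t' - s) * v s x| <= (t' - s) * V.
    by rewrite normrM ger0_norm// ler_wpM2l// vV.
  rewrite /P (_ : u t' x = u s x + (t' - s) * v s x +
    (u t' x - u s x - (t' - s) * v s x)); last by ring.
  rewrite mul0r addr0; apply: (le_trans (ler_normD _ _)); rewrite lerD//.
  by apply: (le_trans (ler_normD _ _)); rewrite lerD.
have := discrete_gronwall V0 (lexx 0) C0 M0 PM Pstep (u0M x) tT ltr01.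
rewrite /P mul0r expR0 mulr1 => /le_trans; apply.
by rewrite lerD2r lerD2l ler_wpM2l.
Qed.

Lemma velocity_bound_bounded_force (w : R -> R) T u v C M Mb :
  C2_bounds a w T u v C -> measurable_fun setT w -> (forall x, `|w x| <= Mb) ->
  (forall x, `|v 0 x| <= M) ->
  forall t x, 0 <= t <= T -> `|v t x| <= M + A * Mb * T + 1.
Proof.
move=> uvC mw wMb v0M t x tT; have [t0 tT'] := andP tT; have T0 := le_trans t0 tT'.
have I0 : (0 : R) <= 0 <= T by rewrite lexx.
have C0 : 0 <= C by have [/gaugeX_ge0] := uvC 0 0 I0 I0.
have Mb0 : 0 <= Mb by exact: le_trans (wMb 0).
have M0 : 0 <= M by exact: le_trans (v0M 0).
have force_le s : 0 <= s <= T -> `|peri_force a w (u s) x| <= A * Mb.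
  move=> sT; have [[mu_ _ _] _ _ _] := uvC s s sT sT.
  have mk : measurable_fun setT (fun y : R => a (y - x) * w (u s y - u s x)).
    apply: measurable_funM; first exact: measurable_shift_kernel.
    by apply: measurableT_comp => //; exact: measurable_funB.
  have ia : (\int[mu]_y (Mb * a (y - x))%:E = (A * Mb)%:E)%E.
    under eq_integral do rewrite EFinM.
    rewrite ge0_integralZl_EFin//.
    - by rewrite (integral_kernel ma a0 aA) -EFinM mulrC.
    - by move=> y _; rewrite lee_fin.
    - by apply/measurable_EFinP; exact: measurable_shift_kernel.
  have le1 : (\int[mu]_y `|a (y - x) * w (u s y - u s x)|%:E <= (A * Mb)%:E)%E.
    rewrite -ia; apply: ge0_le_integral => //.
    - exact: measurable_norm_EFin.
    - apply/measurable_EFinP; apply: measurable_funM => //.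
      exact: measurable_shift_kernel.
    - by move=> y _; rewrite lee_fin normrM (ger0_norm (a0 _)) mulrC ler_wpM2r.
  rewrite -lee_fin EFin_normr_Rintegral//; last first.
    apply/integrableP; split; first exact/measurable_EFinP.
    exact: le_lt_trans le1 (ltry _).
  apply: le_trans le1; apply: le_abse_integral => //; exact/measurable_EFinP.
have AMb : 0 <= A * Mb by rewrite mulr_ge0.
pose P s r := `|v s x| <= r.
have PM s r r' : P s r -> r <= r' -> P s r' by exact: le_trans.
have Pstep s t' r : 0 <= s -> s <= t' -> t' <= T -> 0 <= r -> P s r ->
    P t' (r + (t' - s) * (A * Mb + 0 * r) + C * (t' - s) ^+ 2).
  move=> s0 st t'T r0 Ps.
  have sI : 0 <= s <= T by rewrite s0 (le_trans st).
  have tI : 0 <= t' <= T by rewrite (le_trans s0 st).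
  have [_ _ _ [_ /(_ x) dv _]] := uvC s t' sI tI.
  have h0 : 0 <= t' - s by rewrite subr_ge0.
  have hv : `|(t' - s) * peri_force a w (u s) x| <= (t' - s) * (A * Mb).
    by rewrite normrM ger0_norm// ler_wpM2l// force_le.
  rewrite /P (_ : v t' x = v s x + (t' - s) * peri_force a w (u s) x +
    (v t' x - v s x - (t' - s) * peri_force a w (u s) x)); last by ring.
  rewrite mul0r addr0; apply: (le_trans (ler_normD _ _)); rewrite lerD//.
  by apply: (le_trans (ler_normD _ _)); rewrite lerD.
have := discrete_gronwall AMb (lexx 0) C0 M0 PM Pstep (v0M x) tT ltr01.
rewrite /P mul0r expR0 mulr1 => /le_trans; apply.
by rewrite lerD2r lerD2l ler_wpM2l.
Qed.

(** The force sees [u] only through differences, which are at most twice its supremum. *)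
Lemma peri_force_trunc (w : R -> R) N u : (forall x : R, `|u x| <= N / 2) ->
  peri_force a (trunc_force w N) u = peri_force a w u.
Proof.
move=> uN; apply/funext => x; apply: eq_Rintegral => y _.
rewrite /trunc_force clip_id//; apply: (le_trans (ler_normB _ _)).
by have := uN x; have := uN y; lra.
Qed.

Lemma C2_bounds_trunc (w : R -> R) N T u v C :
  (forall t, 0 <= t <= T -> forall x, `|u t x| <= N / 2) ->
  C2_bounds a (trunc_force w N) T u v C <-> C2_bounds a w T u v C.
Proof.
move=> uN; split=> uvC s t sT tT; have [H1 H2 H3 H4] := uvC s t sT tT;
  by split=> //; rewrite peri_force_trunc in H4 *; auto.
Qed.

End uniqueness.

(** * Removing the truncation *)

Section global.
Variable R : realType.
Notation mu := (@lebesgue_measure R).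
Variables (a : R -> R) (A amax : R).
Hypothesis ma : measurable_fun setT a.
Hypothesis a0 : forall x, 0 <= a x.
Hypothesis aN : forall x, a (- x) = a x.
Hypothesis aA : (\int[mu]_x (a x)%:E = A%:E)%E.
Hypothesis amaxP : forall x, a x <= amax.

Variables (w : R -> R) (q Cw : R).
Hypothesis dw : forall x, derivable w x 1.
Hypothesis cdw : continuous (derive1 w).
Hypothesis wN : forall x, w (- x) = - w x.
Hypothesis w0 : w 0 = 0.
Hypothesis W_ge0 : forall x, 0 <= Wprim w x.
Hypothesis q43 : 4 / 3 <= q.
Hypothesis Cw0 : 0 < Cw.
Hypothesis wW : forall x, `|w x| `^ q <= Cw * Wprim w x.

Variables (phi psi : R -> R) (M : R).
Hypothesis phiM : gaugeX phi M.
Hypothesis psiM : gaugeX psi M.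

Let gX := gaugeX_is_gauge R.
Let M0 : 0 <= M. Proof. exact: gaugeX_ge0 phiM. Qed.

Let cw : continuous w.
Proof. by move=> x; apply: differentiable_continuous; exact/derivable1_diffP. Qed.

Let W0 : Wprim w 0 = 0.
Proof. by rewrite /Wprim lexx set_itv1 Rintegral_set1. Qed.


Let clip0 N : 0 <= N -> clip N 0 = 0 :> R.
Proof. by move=> N0; apply: clip_id; rewrite normr0. Qed.

Let force0 N : 0 <= N -> trunc_force w N 0 = 0.
Proof. by move=> N0; rewrite /trunc_force clip0. Qed.

Let potential0 N : 0 <= N -> trunc_potential w (Wprim w) N 0 = 0.
Proof. by move=> N0; rewrite /trunc_potential clip0// W0 subrr mulr0 addr0. Qed.

Lemma trunc_forceN N x : 0 <= N -> trunc_force w N (- x) = - trunc_force w N x.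
Proof. by move=> N0; rewrite /trunc_force clipN. Qed.

(** This is the affine part of the truncated potential. Its sign is what preserves both the
    nonnegativity of the potential and the growth condition outside [[- N, N]]. *)
Lemma trunc_outward N x : 0 <= N -> 0 <= w N ->
  0 <= w (clip N x) * (x - clip N x).
Proof.
move=> N0 wN0; have [] := clip_cases x N0 => -[xN ->].
- by rewrite mulr_ge0// subr_ge0.
- by rewrite subrr mulr0.
- by rewrite wN mulNr -mulrN mulr_ge0//; lra.
Qed.

(** Differences of [phi] stay within [2 * M], where [W] agrees with its truncation. The resulting
    bound on the initial energy does not depend on the later truncation level. *)
Lemma energy_phi_gaugeX : exists Gam, gaugeX (peri_force a (Wprim w) phi) Gam.
Proof.
have N0 : 0 <= 2 * M by rewrite mulr_ge0.
have [L L0 wL] := C1_lipschitz_itv N0 dw cdw.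
have W2 := trunc_potential_second_order N0 L0 wL (Wprim_second_order cw wL).
have H0 : 0 <= 3 * L by rewrite mulr_ge0.
have G := energy_gaugeX ma a0 aN aA (force0 N0) H0 (potential0 N0) W2 phiM.
exists (2 * A * (3 * L * (2 * M) * M)); apply: (gauge_eq gX G) => // x.
apply: eq_Rintegral => y _; rewrite /trunc_potential clip_id ?subrr ?mulr0 ?addr0//.
have [_ pM _] := phiM; apply: (le_trans (ler_normB _ _)).
by have := pM x; have := pM y; lra.
Qed.

(* If [w] were negative from some point on, [W] would decrease there, hence stay
   bounded, and so would [w] by the growth condition. *)
Lemma unbounded_force : (forall Mb, ~ forall x, `|w x| <= Mb) ->
  forall m, exists2 N, m <= N & 0 <= w N.
Proof.
move=> wb m0; apply: contrapT => H.
pose m := Num.max 0 m0; have m_ge0 : 0 <= m by rewrite le_max lexx.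
have neg N : m <= N -> w N < 0.
  move=> mN; rewrite ltNge; apply/negP => wN0; apply: H; exists N => //.
  by apply: le_trans mN; rewrite le_max lexx orbT.
have [L L0 wL] := C1_lipschitz_itv m_ge0 dw cdw.
pose D := Cw * Wprim w m; have D0 : 0 <= D by rewrite mulr_ge0// ltW.
have Lm0 : 0 <= L * m by rewrite mulr_ge0.
have pos x : 0 <= x -> `|w x| <= 1 + D + L * m.
  move=> x0; have [mx|/ltW xm] := leP m x; last first.
    have := wL x 0; rewrite w0 !subr0 (ger0_norm x0) => /(_ _ _)/le_trans; apply.
    - by lra.
    - by lra.
    - have : L * x <= L * m by rewrite ler_wpM2l.
      by lra.
  have Wm : Wprim w x <= Wprim w m.
    rewrite -subr_le0 (Wprim_diff cw mx).
    rewrite -[leRHS](_ : \int[mu]_(z in `[m, x]) 0 = 0); last first.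
      by rewrite Rintegral_cst// mul0r.
    apply: le_Rintegral => //.
    - exact: continuous_integrable_itv.
    - by apply: continuous_integrable_itv; exact: cst_continuous.
    - by move=> z; rewrite /= in_itv/= => /andP[mz _]; rewrite ltW// neg.
  have [w1|w1] := leP `|w x| 1; first by lra.
  have : `|w x| <= D.
    apply: (@le_trans _ _ (`|w x| `^ q)).
      rewrite -[leLHS]powRr1//; apply: ler_powR; first exact: ltW.
      by apply: le_trans q43; lra.
    by apply: (le_trans (wW x)); rewrite ler_wpM2l// ltW.
  by lra.
apply: (wb (1 + D + L * m)) => x; have [x0|/ltW x0] := leP 0 x; first exact: pos.
by rewrite -[x]opprK wN normrN pos// oppr_ge0.
Qed.

(** [V] precedes [N]: the level can then be taken above any threshold computed from [V], without
    circularity. Levels exist beyond every [m], either because [w] is bounded or because [w N] is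
    nonnegative for arbitrarily large [N]. *)
Lemma velocity_apriori T : 0 <= T -> exists V, forall m, exists2 N, m <= N &
  0 <= N /\ forall u v C, C2_bounds a (trunc_force w N) T u v C ->
    u 0 = phi -> v 0 = psi -> forall t, 0 <= t <= T -> forall x, `|v t x| <= V.
Proof.
move=> T0; have [[Mb wMb]|wb] := pselect (exists Mb, forall x, `|w x| <= Mb).
  exists (M + A * Mb * T + 1) => m; exists (Num.max 0 m).
    by rewrite le_max lexx orbT.
  have N0 : 0 <= Num.max 0 m by rewrite le_max lexx.
  split=> // u v C uvC u0 v0 t tT x.
  have [L L0 wL] := C1_lipschitz_itv N0 dw cdw.
  apply: (velocity_bound_bounded_force ma a0 aA uvC) tT.
  - exact: lipschitz_measurable (trunc_force_lipschitz N0 L0 wL).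
  - by move=> y; exact: wMb.
  - by rewrite v0; case: psiM.
have [Gam phiG] := energy_phi_gaugeX.
exists (1 + 2 * ((M ^+ 2 / 2 + Gam + A * T) *
  expR ((Cw + 4 * amax * (M ^+ 2 / 2 + Gam / 2)) * T) + 1)) => m.
(* Beyond [2 * M] the truncation does not affect the initial energy, so [Gam] serves for every such
   [N]. *)
have [|N mN wN0] := unbounded_force _ (Num.max m (2 * M)).
  by move=> Mb wMb; apply: wb; exists Mb.
move: mN; rewrite ge_max => /andP[mN MN]; exists N => //.
have N0 : 0 <= N by apply: le_trans MN; rewrite mulr_ge0.
split=> // u v C uvC u0 v0 t tT x.
have [L L0 wL] := C1_lipschitz_itv N0 dw cdw.
have H0 : 0 <= 3 * L by rewrite mulr_ge0.
have Wge0 y : 0 <= trunc_potential w (Wprim w) N y.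
  by rewrite /trunc_potential addr_ge0// trunc_outward.
have wMb y : `|trunc_force w N y| <= L * N.
  have cI := clip_itv y N0; rewrite /trunc_force.
  have := wL (clip N y) 0 cI; rewrite w0 !subr0 => /(_ _)/le_trans; apply.
    by lra.
  by rewrite ler_wpM2l// ler_norml.
have young y z : `|trunc_force w N y * z| <=
    1 + Cw * trunc_potential w (Wprim w) N y + z ^+ 4.
  apply: (young_quartic _ q43); first by rewrite mulr_ge0// ltW.
  apply: (le_trans (wW (clip N y))); rewrite ler_wpM2l ?(ltW Cw0)//.
  by rewrite /trunc_potential lerDl trunc_outward.
have u0G : gaugeX (peri_force a (trunc_potential w (Wprim w) N) (u 0)) Gam.
  rewrite u0; apply: (gauge_eq gX phiG) => // y.
  apply: eq_Rintegral => z _; rewrite /trunc_potential clip_id ?subrr ?mulr0 ?addr0//.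
  have [_ pM _] := phiM; apply: (le_trans (ler_normB _ _)).
  by have := pM y; have := pM z; lra.
have v0M : gaugeX (v 0) M by rewrite v0.
exact: (velocity_bound ma a0 aN aA amaxP L0 (trunc_force_lipschitz N0 L0 wL)
  (force0 N0) (fun y => trunc_forceN y N0) wMb H0 (potential0 N0) Wge0
  (trunc_potential_second_order N0 L0 wL (Wprim_second_order cw wL))
  uvC (ltW Cw0) young v0M u0G x tT).
Qed.

Lemma local_solution T : 0 <= T -> exists u v : R -> R -> R,
  [/\ u 0 = phi, v 0 = psi & exists C, C2_bounds a w T u v C].
Proof.
move=> T0; have [V HV] := velocity_apriori T0.
(* Twice the bound of [displacement_bound]: the truncated solution never reaches the truncation and
   solves the original equation. *)
have [N UN [N0 HN]] := HV (2 * (M + V * T + 1)).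
have [L L0 wL] := C1_lipschitz_itv N0 dw cdw.
have [u [v [u0 v0 uvT]]] := peri_lipschitz_solution ma a0 aN aA L0
  (trunc_force_lipschitz N0 L0 wL) (force0 N0) phiM psiM.
have [C uvC] := uvT T T0; exists u, v; split=> //; exists C.
have vV := HN u v C uvC u0 v0.
have u0M y : `|u 0 y| <= M by rewrite u0; case: phiM.
have uN t : 0 <= t <= T -> forall x, `|u t x| <= N / 2.
  by move=> tT x; have := displacement_bound uvC u0M vV x tT; lra.
exact: (C2_bounds_trunc a w v C uN).1 uvC.
Qed.

(** Both solutions are bounded on [[0, T]], so they also solve the equation truncated at a level
    above their differences, where the force is Lipschitz. *)
Lemma C2_bounds_unique T u v C u' v' C' :
  C2_bounds a w T u v C -> C2_bounds a w T u' v' C' ->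
  u 0 = u' 0 -> v 0 = v' 0 ->
  forall t, 0 <= t <= T -> u t = u' t /\ v t = v' t.
Proof.
move=> uvC uvC' u0 v0 t tT.
pose N := 2 * (`|C| + `|C'|); have N0 : 0 <= N by rewrite mulr_ge0// addr_ge0.
have [L L0 wL] := C1_lipschitz_itv N0 dw cdw.
have uN s : 0 <= s <= T -> forall x, `|u s x| <= N / 2.
  move=> sT x; have [[_ /(_ x) uC _] _ _ _] := uvC s s sT sT.
  by have := ler_norm C; have := normr_ge0 C'; rewrite /N; lra.
have uN' s : 0 <= s <= T -> forall x, `|u' s x| <= N / 2.
  move=> sT x; have [[_ /(_ x) uC _] _ _ _] := uvC' s s sT sT.
  by have := ler_norm C'; have := normr_ge0 C; rewrite /N; lra.
have {}uvC := (C2_bounds_trunc a w v C uN).2 uvC.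
have {}uvC' := (C2_bounds_trunc a w v' C' uN').2 uvC'.
exact: (C2_bounds_unique_lipschitz ma a0 aN aA L0
  (trunc_force_lipschitz N0 L0 wL) (force0 N0) uvC uvC' u0 v0 tT).
Qed.

(** The value at time [t] is read off the solution built on [[0, t]]; by uniqueness it is also the
    value at [t] of the solution built on any longer interval. *)
Lemma global_bounds : exists u v : R -> R -> R,
  [/\ u 0 = phi, v 0 = psi &
    forall T, 0 <= T -> exists C, C2_bounds a w T u v C].
Proof.
have H T : exists uv : (R -> R -> R) * (R -> R -> R), 0 <= T ->
    [/\ uv.1 0 = phi, uv.2 0 = psi & exists C, C2_bounds a w T uv.1 uv.2 C].
  have [T0|T0] := boolP (0 <= T); last by exists (fun=> phi, fun=> psi).
  by have [u [v uv]] := local_solution T0; exists (u, v).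
have {H}[f fP] := choice H.
exists (fun t => (f t).1 t), (fun t => (f t).2 t).
have [f0 g0 _] := fP 0 (lexx 0); split=> // T T0.
have [fT gT [C HC]] := fP T T0; exists C.
have same t : 0 <= t <= T -> (f t).1 t = (f T).1 t /\ (f t).2 t = (f T).2 t.
  move=> /andP[t0 tT]; have [ft gt [C' HC']] := fP t t0.
  apply: (C2_bounds_unique HC' (C2_bounds_le tT HC)).
  - by rewrite ft fT.
  - by rewrite gt gT.
  - by rewrite t0 lexx.
move=> s t sT tT; have [-> ->] := same s sT; have [-> ->] := same t tT.
exact: HC.
Qed.

End global.

(** * From everywhere estimates to classes of functions *)

Section conversions.
Variable R : realType.
Notation mu := (@lebesgue_measure R).

Lemma Xnorm_ge0 (f : R -> R) : (0 <= Xnorm f)%E.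
Proof. by rewrite adde_ge0// Lnorm_ge0. Qed.

Lemma gaugeX_Xnorm (f : R -> R) M : gaugeX f M -> (Xnorm f <= (2 * M)%:E)%E.
Proof.
move=> fM; have M0 := gaugeX_ge0 fM; have [mf fb fi] := fM.
rewrite /Xnorm Lnorm1 mulr_natl mulr2n EFinD leeD//.
rewrite unlock; case: ifPn => _; last by rewrite lee_fin.
by apply: ess_sup_ler => x; rewrite lee_fin.
Qed.

Lemma gaugeX_inL1Linf (f : R -> R) M : gaugeX f M -> inL1Linf f.
Proof.
move=> fM; have [mf fb _] := fM; split=> //; split; first exact: gaugeX_integrable fM.
by exists M; exact: aeW.
Qed.

Lemma Xnorm_cvg0 (t c : R) (F : set_system R) (f : R -> R -> R) :
  Filter F -> F `=>` nbhs t ->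
  (\forall s \near F, gaugeX (f s) (c * `|s - t|)) ->
  (fun s => Xnorm (f s)) @ F --> 0%E.
Proof.
move=> FF Ft fc.
apply: (@squeeze_cvge _ F _ _ (fun=> 0%E) _ (fun s => (2 * (c * `|s - t|))%:E)).
- by apply: filterS fc => s /gaugeX_Xnorm fs; rewrite Xnorm_ge0 fs.
- exact: cvg_cst.
- apply: cvg_EFin; first exact: nearW.
  apply: cvg_trans (cvg_app _ Ft) _.
  rewrite (_ : 0 = 2 * (c * `|t - t|)); last by rewrite subrr normr0 !mulr0.
  apply: cvgZr; apply: cvgZr; apply: cvg_norm; apply: cvgB; [exact: cvg_id|exact: cvg_cst].
Qed.

Lemma C2_bounds_Xderiv (T C : R) (u v : R -> R -> R) :
  (forall s t, 0 <= s <= T -> 0 <= t <= T ->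
    gaugeX (fun x => u t x - u s x - (t - s) * v s x) (C * (t - s) ^+ 2)) ->
  Xderiv_on T u v.
Proof.
move=> uvC t; rewrite in_itv/= => tT; apply: (@Xnorm_cvg0 t C).
  apply: cvg_trans; first exact: cvg_within.
  exact: cvg_within.
rewrite near_withinE; apply: filterS (nbhs_dnbhs_neq t) => s st.
rewrite /= in_itv/= => sT.
have st0 : s - t != 0 by rewrite subr_eq0.
have g := gaugeX_is_gauge R.
apply: (gauge_eq g (gaugeZ g (s - t)^-1 (uvC t s tT sT))) => [x|].
  by field.
have n0 : `|s - t| != 0 by rewrite normr_eq0.
rewrite normfV -(real_normK (num_real (s - t))) le_eqVlt; apply/orP; left.
by apply/eqP; field.
Qed.

Lemma C2_bounds_Xcont (T C : R) (u : R -> R -> R) :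
  (forall s t, 0 <= s <= T -> 0 <= t <= T ->
    gaugeX (fun x => u t x - u s x) (C * `|t - s|)) ->
  Xcont_on T u.
Proof.
move=> uC t; rewrite in_itv/= => tT; apply: (@Xnorm_cvg0 t C).
  exact: cvg_within.
rewrite near_withinE; apply: nearW => s; rewrite /= in_itv/= => sT.
exact: uC.
Qed.

Lemma ae_imply (P Q : R -> Prop) : (forall x, P x -> Q x) ->
  {ae mu, forall x, P x} -> {ae mu, forall x, Q x}.
Proof. by move=> PQ; apply: negligibleS => x /= nQ Px; apply: nQ; exact: PQ. Qed.

Lemma ae_and (P Q : R -> Prop) : {ae mu, forall x, P x} ->
  {ae mu, forall x, Q x} -> {ae mu, forall x, P x /\ Q x}.
Proof.
move=> aP aQ; apply: negligibleS (negligibleU aP aQ) => x /= /not_andP[nP|nQ].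
  by left.
by right.
Qed.

Lemma ae_shift (P : R -> Prop) (x : R) :
  {ae mu, forall y, P y} -> {ae mu, forall y, P (y - x)}.
Proof.
move=> [B [mB B0 PB]].
have ms : measurable_fun setT (fun y : R => y - x) by exact: measurable_funB.
exists ((fun y => y - x) @^-1` B); split.
- by rewrite -[X in measurable X]setTI; exact: ms.
- by rewrite -[RHS]B0 -(lebesgue_measure_shift x mB).
- by move=> y /= Py; exact: PB.
Qed.

(** Clipping at an essential bound changes [f] on a null set only, and as a contraction fixing 0 it
    does not increase the L^1 norm. *)
Lemma inL1Linf_gaugeX (f : R -> R) : inL1Linf f ->
  exists g M, gaugeX g M /\ {ae mu, forall x, g x = f x}.
Proof.
move=> [mf [/integrableP[_ fi] [N fN]]].
pose N' := `|N|; have N0 : 0 <= N' by exact: normr_ge0.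
have mc : measurable_fun setT (@clip R N').
  apply: continuous_measurable_fun; apply: locally_lipschitz_continuous => x.
  by exists 1 => y _; rewrite mul1r clip_lipschitz.
have mg : measurable_fun setT (fun x => clip N' (f x)) by exact: measurableT_comp.
pose I := fine (\int[mu]_x `|f x|%:E)%E.
have IE : (\int[mu]_x `|f x|%:E = I%:E)%E.
  by rewrite fineK// ge0_fin_numE// integral_ge0.
exists (fun x => clip N' (f x)), (Num.max N' I); split; last first.
  apply: ae_imply fN => x fx; apply: clip_id.
  by apply: (le_trans fx); exact: ler_norm.
split=> // [x|].
  by rewrite le_max ler_norml clip_itv.
apply: (@le_trans _ _ I%:E); last by rewrite lee_fin le_max lexx orbT.
rewrite -IE; apply: ge0_le_integral => //; [exact: measurable_norm_EFin..|].
move=> x _; rewrite lee_fin; have := clip_lipschitz (f x) 0 N0.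
by rewrite subr0 (clip_id (x := 0)) ?normr0// subr0.
Qed.

(** Averaging with the reflection gives evenness, clipping a bound and the absolute value the sign,
    now at every point. Each operation keeps what the previous ones achieved and acts trivially
    almost everywhere. *)
Lemma symmetric_kernel (alpha : R -> R) : inL1Linf alpha ->
  {ae mu, forall x, alpha (- x) = alpha x} -> {ae mu, forall x, 0 <= alpha x} ->
  exists (a : R -> R) (amax A : R), [/\ [/\ measurable_fun setT a, forall x, 0 <= a x,
    forall x, a (- x) = a x & forall x, a x <= amax],
    (\int[mu]_x (a x)%:E = A%:E)%E & {ae mu, forall x, a x = alpha x}].
Proof.
move=> [malpha [/integrableP[_ ialpha] [N alphaN]]] alpha_even alpha_ge0.
pose N' := `|N|; have N0 : 0 <= N' by exact: normr_ge0.
pose a x := `|clip N' ((alpha x + alpha (- x)) / 2)|.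
have mc : measurable_fun setT (@clip R N').
  apply: continuous_measurable_fun; apply: locally_lipschitz_continuous => x.
  by exists 1 => y _; rewrite mul1r clip_lipschitz.
have ma : measurable_fun setT a.
  apply: measurableT_comp => //; apply: measurableT_comp => //.
  apply: measurable_funM => //; apply: measurable_funD => //.
  exact: measurableT_comp.
have aE : {ae mu, forall x, a x = alpha x}.
  apply: ae_imply (ae_and alpha_even (ae_and alpha_ge0 alphaN)) => x [e [p m]].
  have -> : a x = `|clip N' (alpha x)| by rewrite /a e; congr (`|clip _ _|); field.
  by rewrite clip_id; [rewrite ger0_norm|exact: le_trans m (ler_norm _)].
pose I := fine (\int[mu]_x `|alpha x|%:E)%E.
have IE : (\int[mu]_x `|alpha x|%:E = I%:E)%E.
  by rewrite fineK// ge0_fin_numE// integral_ge0.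
exists a, N', I; split=> //.
  split=> // x.
  - exact: normr_ge0.
  - by rewrite /a opprK addrC.
  - by rewrite ler_norml clip_itv.
rewrite -IE; apply: ae_eq_integral => //; first exact/measurable_EFinP.
  exact: measurable_norm_EFin.
by apply: ae_imply aE => x ax _ /=; rewrite -ax ger0_norm// normr_ge0.
Qed.

End conversions.

Theorem theorem4p3 (R : realType) (alpha w phi psi : R -> R) (q C : R) :
  inL1Linf alpha ->
  {ae (@lebesgue_measure R), forall x, alpha (- x) = alpha x} ->
  {ae (@lebesgue_measure R), forall x, 0 <= alpha x} ->
  (forall x, derivable w x 1) -> continuous (derive1 w) ->
  (forall x, w (- x) = - w x) -> w 0 = 0 ->
  (forall eta, 0 <= Wprim w eta) ->
  4 / 3 <= q -> 0 < C ->
  (forall eta, `|w eta| `^ q <= C * Wprim w eta) ->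
  inL1Linf phi -> inL1Linf psi ->
  global_solution alpha w phi psi.
Proof.
move=> alphaX alpha_even alpha_ge0 dw cdw wN w0 W_ge0 q43 C0 wW phiX psiX.
have [a [amax [A [[ma a0 aN amaxP] aA aE]]]] :=
  symmetric_kernel alphaX alpha_even alpha_ge0.
have [phi' [M1 [phiM phiE]]] := inL1Linf_gaugeX phiX.
have [psi' [M2 [psiM psiE]]] := inL1Linf_gaugeX psiX.
have gX := gaugeX_is_gauge R.
have phiM' : gaugeX phi' (Num.max M1 M2).
  by apply: (gauge_le gX phiM); rewrite le_max lexx.
have psiM' : gaugeX psi' (Num.max M1 M2).
  by apply: (gauge_le gX psiM); rewrite le_max lexx orbT.
have [u [v [u0 v0 uvT]]] := global_bounds ma a0 aN aA amaxP dw cdw wN w0 W_ge0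
  q43 C0 wW phiM' psiM'.
exists u, v, (fun t => peri_force a w (u t)) => T T0.
have [D uvD] := uvT T (ltW T0).
have cw : continuous w.
  by move=> x; apply: differentiable_continuous; exact/derivable1_diffP.
have D0 : 0 <= D.
  have I0 : (0 : R) <= 0 <= T by rewrite lexx ltW.
  by have [/gaugeX_ge0] := uvD 0 0 I0 I0.
(* Since [D] bounds the solution on [[0, T]], the force may again be replaced by a Lipschitz
   truncation; this makes the second derivative Lipschitz in time. *)
pose N := 2 * D; have N0 : 0 <= N by rewrite mulr_ge0.
have [L L0 wL] := C1_lipschitz_itv N0 dw cdw.
have uN s : 0 <= s <= T -> forall x, `|u s x| <= N / 2.
  by move=> sT x; have [[_ /(_ x) uD _] _ _ _] := uvD s s sT sT; rewrite /N; lra.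
have fL := trunc_force_lipschitz N0 L0 wL.
have f0 : trunc_force w N 0 = 0.
  by rewrite /trunc_force clip_id ?normr0.
have forceX s : 0 <= s <= T -> gaugeX (peri_force a w (u s)) (2 * A * (L * D)).
  move=> sT; have [us _ _ _] := uvD s s sT sT.
  by rewrite -(peri_force_trunc a w (uN s sT)); exact: (peri_force_gaugeX ma a0 aN aA L0 fL f0 us).
have A0 : 0 <= A by rewrite -lee_fin -aA integral_ge0// => x _; rewrite lee_fin.
split.
  move=> t; rewrite in_itv/= => tT; have [ut vt _ _] := uvD t t tT tT.
  split; [exact: gaugeX_inL1Linf ut|exact: gaugeX_inL1Linf vt|].
  exact: gaugeX_inL1Linf (forceX t tT).
split.
  by apply: (@C2_bounds_Xderiv _ T D) => s t sT tT; have [] := uvD s t sT tT.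
split.
  by apply: (@C2_bounds_Xderiv _ T D) => s t sT tT; have [] := uvD s t sT tT.
split.
  apply: (@C2_bounds_Xcont _ T (2 * A * (L * (D * T + D)))) => s t sT tT.
  have [us vs du _] := uvD s t sT tT; have [ut _ _ _] := uvD t s tT sT.
  have dut := gaugeD gX du (gaugeZ gX (t - s) vs).
  have dut' : gaugeX (fun x => u t x - u s x) ((D * T + D) * `|t - s|).
    apply: (gauge_eq gX dut) => [x|]; first by ring.
    have tsT : `|t - s| <= T by rewrite ler_norml; lra.
    rewrite -(real_normK (num_real (t - s))) mulrDl [`|t - s| * D]mulrC lerD2r.
    by rewrite expr2 mulrA ler_wpM2r// ler_wpM2l.
  have := peri_force_lipschitz ma a0 aN aA L0 fL f0 ut us dut'.
  rewrite (peri_force_trunc a w (uN s sT)) (peri_force_trunc a w (uN t tT)).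
  by move=> K; apply: (gauge_eq gX K) => //; lra.
split; last by rewrite u0 v0.
(* The solution was built with the modified kernel [a]. A translate of a null set is null, so [a]
   and [alpha] give the same integral for every [x]. *)
move=> t; rewrite in_itv/= => /andP[t0 tT]; apply: aeW => x.
have tI : 0 <= t <= T by rewrite (ltW t0).
have [[mut _ _] _ _ _] := uvD t t tI tI; have [malpha _] := alphaX.
have mw := continuous_measurable_fun cw.
have mwu : measurable_fun setT (fun y : R => w (u t y - u t x)).
  by apply: measurableT_comp => //; exact: measurable_funB.
rewrite /peri_force /Rintegral; congr fine; apply: ae_eq_integral => //.
- apply/measurable_EFinP; apply: measurable_funM => //.
  exact: measurable_shift_kernel.
- apply/measurable_EFinP; apply: measurable_funM => //.
  exact: measurable_shift_kernel.
- by apply: ae_imply (ae_shift x aE) => y ay _ /=; rewrite ay.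
Qed.
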